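(* Let $A:\mathbb{H}\rightrightarrows\mathbb{H}$ and $B:\mathbb{H}\rightrightarrows\mathbb{H}$ be respectively maximally $\alpha$- and $\beta$-monotone. Suppose that $\mu=\lambda=2$, $\gamma=\delta>0$, $\epsilon\in(0,1)$, $\alpha+\beta>0$ and $\frac{\gamma\alpha\beta}{\alpha+\beta}>\epsilon-1$, and that $\inf_{t\in[t_0,+\infty)}\theta(t)>0$. Write $T:=R_{\delta B}^{\mu}R_{\gamma A}^{\lambda}$. Let $u(t)$ be the trajectory (unique strong global solution) of $$\frac{du}{dt}+\theta(t)\,[u(t)-T(u(t))]=f(t),\qquad u(t_0)=u_0\in\mathbb{H},$$ and let $u^*\in\operatorname{Fix}(T)$. Then: (i) $\int_{t_0}^{+\infty}\|Tu(s)-u(s)\|^2ds<+\infty$. (ii) $\lim_{t\to+\infty}\|Tu(t)-u(t)\|=0$. (iii) If $T$ satisfies the demiclosedness principle, then there exists $\hat u\in\operatorname{Fix}(T)$ such that $u(t)$ converges weakly to $\hat u$ as $t\to+\infty$. (iv) $\int_{t_0}^{+\infty}\|\alpha(J_{\gamma A}u(s)-J_{\gamma A}u^* )+\beta(J_{\delta B}R_{\gamma A}^{\lambda}u(s)-J_{\delta B}R_{\gamma A}^{\lambda}u^* )\|^2ds<+\infty$. (v) $\lim_{t\to+\infty}\|\alpha(J_{\gamma A}u(t)-J_{\gamma A}u^* )+\beta(J_{\delta B}R_{\gamma A}^{\lambda}u(t)-J_{\delta B}R_{\gamma A}^{\lambda}u^* )\|=0$. (vi) $\lim_{t\to+\infty}J_{\gamma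 A}u(t)=J_{\gamma A}u^*=\lim_{t\to+\infty}J_{\delta B}R_{\gamma A}^{\lambda}u(t)=J_{\delta B}R_{\gamma A}^{\lambda}u^*$ (limits in norm), and this common point is the unique element of $\operatorname{zer}(A+B)$.
   Context: $\mathbb{H}$ is a real Hilbert space, $I$ its identity operator, $t_0>0$, $\theta:[t_0,+\infty)\to[0,+\infty)$ is locally integrable, and $f:[t_0,+\infty)\to\mathbb{H}$ belongs to $L^1([t_0,+\infty))$. A set-valued operator $A:\mathbb{H}\rightrightarrows\mathbb{H}$ is $\alpha$-monotone ($\alpha\in\mathbb{R}$) if $\langle x-y,u-v\rangle\ge\alpha\|x-y\|^2$ whenever $u\in Ax$, $v\in Ay$; it is maximally $\alpha$-monotone if moreover no $\alpha$-monotone operator has a graph strictly containing that of $A$. $J_{\gamma A}=(I+\gamma A)^{-1}$, $R_{\gamma A}^{\lambda}=(1-\lambda)I+\lambda J_{\gamma A}$, $J_{\delta B}=(I+\delta B)^{-1}$, $R_{\delta B}^{\mu}=(1-\mu)I+\mu J_{\delta B}$; under the hypotheses of the claim these are single-valued with full domain (known). $\operatorname{zer}(A+B)=\{x:0\in Ax+Bx\}$; $\operatorname{Fix}(T)=\{x:Tx=x\}$. $T$ satisfies the demiclosedness principle if, for every sequence $(x_k)$ converging weakly to $x^*$ with $\|Tx_k-x_k\|\to0$, one has $Tx^*=x^*$. A strong global solution is a function $u:[t_0,+\infty)\to\mathbb{H}$ that is absolutely continuous on each interval $[t_0,b]$, $t_0<b<+\infty$, satisfies the differential equation for almost every $t\ge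 t_0$, and satisfies $u(t_0)=u_0$; it exists and is unique here. *)

(* Defs.v *)
From HB Require Import structures.
From mathcomp Require Import all_boot all_order all_algebra.
From mathcomp Require Import sesquilinear.
From mathcomp Require Import all_classical all_reals all_analysis.
Export numFieldNormedType.Exports.

Set Implicit Arguments.
Unset Strict Implicit.
Unset Printing Implicit Defensive.

Import Order.TTheory GRing.Theory Num.Theory.

Local Open Scope classical_set_scope.
Local Open Scope ring_scope.

(* A real Hilbert space is a complete normed module [H] over [R] with an inner
   product [dot] inducing its norm. *)
Definition induces_norm (R : realType) (H : completeNormedModType R)
    (dot : {dot H for idfun}) : Prop :=
  forall x : H, `|x| = Num.sqrt (dot x x).

Definition weak_cvg (R : realType) (H : completeNormedModType R)
    (dot : {dot H for idfun}) (I : Type) (F : set_system I)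
    (x : I -> H) (l : H) : Prop :=
  forall y : H, dot (x i) y @[i --> F] --> dot l y.

(* A set-valued operator on [H] is a map [A : H -> set H]; [A x u] means that
   [u] belongs to [A x]. *)

Definition graph (T U : Type) (A : T -> set U) : set (T * U) :=
  [set p | A p.1 p.2].

Definition monotone_op (R : realType) (H : completeNormedModType R)
    (dot : {dot H for idfun}) (alpha : R) (A : H -> set H) : Prop :=
  forall x y u v : H, A x u -> A y v ->
    alpha * `|x - y| ^+ 2 <= dot (x - y) (u - v).

Definition max_monotone_op (R : realType) (H : completeNormedModType R)
    (dot : {dot H for idfun}) (alpha : R) (A : H -> set H) : Prop :=
  monotone_op dot alpha A /\
  ~ exists2 A' : H -> set H, monotone_op dot alpha A' & graph A `<` graph A'.

Definition add_op (V : zmodType) (A B : V -> set V) : V -> set V :=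
  fun x => [set a + b | a in A x & b in B x].

Definition zer (V : zmodType) (A : V -> set V) : set V := [set x | A x 0].

Definition Fix (T : Type) (S : T -> T) : set T := [set x | S x = x].

(* The set-valued inverse of [I + gamma A]. *)
Definition resolvent_set (R : realType) (H : completeNormedModType R)
    (gamma : R) (A : H -> set H) : H -> set H :=
  fun x => [set p | exists2 a, A p a & p + gamma *: a = x].

(* The point of [resolvent_set gamma A x] when that set is a singleton; the
   value 0 is only used where the set is empty. *)
Definition resolvent (R : realType) (H : completeNormedModType R)
    (gamma : R) (A : H -> set H) : H -> H :=
  fun x => xget 0 (resolvent_set gamma A x).

Definition relaxed_resolvent (R : realType) (H : completeNormedModType R)
    (lambda gamma : R) (A : H -> set H) : H -> H :=
  fun x => (1 - lambda) *: x + lambda *: resolvent gamma A x.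

Definition demiclosedness_principle (R : realType)
    (H : completeNormedModType R) (dot : {dot H for idfun})
    (T : H -> H) : Prop :=
  forall (x : nat -> H) (xs : H),
    weak_cvg dot \oo x xs ->
    `|T (x k) - x k| @[k --> \oo] --> (0 : R) ->
    T xs = xs.

Definition simple_fun (R : realType) (V : normedModType R) (s : R -> V) : Prop :=
  finite_set (range s) /\
  forall c : V, measurable (s @^-1` [set c] : set (measurableTypeR R)).

(* Strong (Bochner) measurability up to null sets; for [V = R] this is Lebesgue
   measurability, whereas [measurable_fun] is Borel measurability. *)
Definition strongly_measurable (R : realType) (V : normedModType R)
    (D : set R) (f : R -> V) : Prop :=
  exists2 s : nat -> R -> V, (forall n, simple_fun (s n)) &
    {ae @lebesgue_measure R, forall t, D t -> s n t @[n --> \oo] --> f t}.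

(* Since the library integral of a nonnegative function is a supremum over the
   Borel simple functions below it, it is the Lebesgue integral of [`|f|] as
   soon as [f] is strongly measurable in the above sense. *)
Definition L1 (R : realType) (V : normedModType R)
    (D : set R) (f : R -> V) : Prop :=
  strongly_measurable D f /\
  (\int[@lebesgue_measure R]_(t in D) (`|f t|)%:E < +oo)%E.

(* The library's [locally_integrable] requires [D] to be open. *)
Definition L1loc (R : realType) (V : normedModType R)
    (D : set R) (f : R -> V) : Prop :=
  strongly_measurable D f /\
  forall K : set R, K `<=` D -> compact K ->
    (\int[@lebesgue_measure R]_(t in K) (`|f t|)%:E < +oo)%E.

Definition absolutely_continuous (R : realType) (V : normedModType R)
    (c d : R) (u : R -> V) : Prop :=
  forall e : R, 0 < e -> exists2 r : R, 0 < r &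
    forall (n : nat) (a b : 'I_n -> R),
      (forall i, c <= a i /\ a i <= b i /\ b i <= d) ->
      trivIset setT (fun i => `]a i, b i[%classic) ->
      \sum_(i < n) (b i - a i) < r ->
      \sum_(i < n) `|u (b i) - u (a i)| < e.

(* [u] is total on [R], but only its values on [t0, +oo) matter. *)
Definition strong_global_solution (R : realType)
    (H : completeNormedModType R) (t0 : R) (theta : R -> R) (T : H -> H)
    (f : R -> H) (u0 : H) (u : R -> H) : Prop :=
  [/\ forall b, t0 < b -> absolutely_continuous t0 b u,
      {ae @lebesgue_measure R, forall t, t0 <= t ->
        derivable u t 1 /\
        u^`()%classic t + theta t *: (u t - T (u t)) = f t}
    & u t0 = u0].

(* Main.v *)
Require Import Defs.
From mathcomp Require Import all_boot all_order all_algebra.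
From mathcomp Require Import sesquilinear.
From mathcomp Require Import all_classical all_reals all_analysis.
From mathcomp Require Import measurable_realfun.
From mathcomp Require Import ring lra.

(** Minty's theorem makes the resolvents everywhere defined. It is proved by
    minimising the Fitzpatrick function of a maximally monotone operator plus
    [(|x|^2 + |u|^2) / 2]: minimising sequences are Cauchy by the parallelogram
    law, and the first-order condition at the minimiser [(x, u)] says that
    [(-u, -x)] is monotonically related to the graph, whence [x = -u].

    With [P], [Q] the differences of the two resolvents, monotonicity of [A]
    and [B] and the identity
    [alpha |P|^2 + beta |Q|^2 = (|alpha P + beta Q|^2 + alpha beta |P - Q|^2) /
    (alpha + beta)] show that [F = I - T] satisfies
    [epsilon/2 |F x - F y|^2 + c |alpha P + beta Q|^2 <= <x - y, F x - F y>].
    The trajectory solves [u' + theta F(u) = f] with [F] cocoercive. Hence the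
    Dini derivatives of [|u - z|] ([F z = 0]) and [|F u|] are at most [|f|] up
    to constants, because a short step [x - eta F x] decreases both [|x - z|]
    and [|F x|], and that of [|u - z|^2] is at most
    [2 M |f| - 2 inf theta <u - z, F u>]. Integrating these a.e. bounds gives
    the integrability of [|F u|^2] and then [F u -> 0]; the claims on the
    resolvents follow from the displayed inequality. For weak convergence,
    every ultrafilter finer than the neighbourhoods of [+oo] has a weak limit
    (Riesz), which is a zero of [F] by monotonicity; Opial's argument shows
    that all these limits agree. *)

Set Implicit Arguments.
Unset Strict Implicit.
Unset Printing Implicit Defensive.

Import Order.TTheory GRing.Theory Num.Theory.

Local Open Scope classical_set_scope.
Local Open Scope ring_scope.

(** * Hilbert space geometry *)

Section inner_product.
Context {R : realType} {H : completeNormedModType R} {dot : {dot H for idfun}}.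
Implicit Types x y z : H.

Lemma dotC x y : dot x y = dot y x.
Proof. by rewrite (hermC dot) expr0 mul1r. Qed.

Lemma dotDl x y z : dot (x + y) z = dot x z + dot y z.
Proof. exact: linearDl. Qed.

Lemma dotDr x y z : dot x (y + z) = dot x y + dot x z.
Proof. exact: linearDr. Qed.

Lemma dotNl x y : dot (- x) y = - dot x y.
Proof. exact: linearNl. Qed.

Lemma dotNr x y : dot x (- y) = - dot x y.
Proof. exact: linearNr. Qed.

Lemma dotZl a x y : dot (a *: x) y = a * dot x y.
Proof. exact: linearZl_LR. Qed.

Lemma dotZr a x y : dot x (a *: y) = a * dot x y.
Proof. by rewrite dotC dotZl dotC. Qed.

Lemma dot0l x : dot 0 x = 0.
Proof. exact: linear0l. Qed.

Lemma dot0r x : dot x 0 = 0.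
Proof. exact: linear0r. Qed.

Definition dotE := (dotDl, dotDr, dotNl, dotNr, dotZl, dotZr).

Hypothesis dot_norm : induces_norm dot.

Lemma dot_ge0 x : 0 <= dot x x.
Proof.
have [->|x0] := eqVneq x 0; last exact/ltW/neq0_dnorm_gt0.
by rewrite dot0l.
Qed.

Lemma dotxx x : dot x x = `|x| ^+ 2.
Proof. by rewrite dot_norm sqr_sqrtr// dot_ge0. Qed.

Lemma cauchy_schwarz x y : `|dot x y| <= `|x| * `|y|.
Proof.
rewrite -(@ler_pXn2r _ 2)// ?nnegrE ?mulr_ge0// exprMn -!dotxx real_normK ?num_real//.
have [->|y0] := eqVneq y 0.
  by rewrite !dot0r expr0n mulr0.
have yy : 0 < dot y y by exact: neq0_dnorm_gt0.
(* This vector is [|y| ^+ 2] times the component of [x] orthogonal to [y]; its squared norm is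
   [dot y y] times the gap in the inequality. *)
have := dot_ge0 (dot y y *: x - dot x y *: y).
rewrite !dotE (dotC y x) => h.
rewrite -subr_ge0 -(pmulr_rge0 _ yy); apply: le_trans h _.
by rewrite le_eqVlt; apply/orP; left; apply/eqP; ring.
Qed.

Lemma ler_dot x y : dot x y <= `|x| * `|y|.
Proof. exact: le_trans (ler_norm _) (cauchy_schwarz x y). Qed.

Lemma cvg_dotr (I : Type) (F : set_system I) {FF : Filter F} (u : I -> H) l y :
  u i @[i --> F] --> l -> dot (u i) y @[i --> F] --> dot l y.
Proof.
move=> ul; apply/cvgrPdist_le => e e0.
have y1 : 0 < `|y| + 1 by rewrite ltr_wpDl.
have /cvgrPdist_le/(_ (e / (`|y| + 1))) := ul; rewrite divr_gt0// => /(_ isT).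
apply: filterS => i h; rewrite -dotNl -dotDl; apply: le_trans (cauchy_schwarz _ _) _.
rewrite -(@divfK _ (`|y| + 1) _ e) ?gt_eqF//; apply: ler_pM => //.
by rewrite lerDl.
Qed.

Lemma cvg_normsq (I : Type) (F : set_system I) {FF : Filter F} (u : I -> H) l :
  u i @[i --> F] --> l -> `|u i| ^+ 2 @[i --> F] --> `|l| ^+ 2.
Proof. by move=> /cvg_norm h; rewrite expr2; apply: cvgM. Qed.

End inner_product.

(** * Minimising sequences and first-order conditions *)

Section minimisation.
Context {R : realType}.

(** Here [d] is a convexity gap. Since [f z] is at least the infimum, two almost-minimisers have a
    gap no larger than the mean of their excesses; for [d] a multiple of the squared distance this
    makes the sequence Cauchy. *)
Lemma minimizing_sequence (T : Type) (S : set T) (f : T -> R) (d : T -> T -> R) :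
  S !=set0 -> has_lbound (f @` S) ->
  (forall x y, S x -> S y ->
    exists2 z, S z & f z + d x y <= (f x + f y) / 2) ->
  exists2 x : nat -> T, (forall n, S (x n)) &
    (forall n, f (x n) <= inf (f @` S) + n.+1%:R^-1) /\
    (forall n k, d (x n) (x k) <= n.+1%:R^-1 + k.+1%:R^-1).
Proof.
move=> [s Ss] lb dP; set m := inf _.
have infS : has_inf (f @` S) by split => //; exists (f s), s.
have /choice[x xP] : forall n : nat, exists x, S x /\ f x <= m + n.+1%:R^-1.
  move=> n; have n0 : (0 : R) < n.+1%:R^-1 by rewrite invr_gt0.
  by have [_ [x Sx <-] /ltW] := inf_adherent n0 infS; exists x.
exists x => [n|]; first exact: (xP n).1.
split=> [n|n k]; first exact: (xP n).2.
have [z Sz] := dP _ _ (xP n).1 (xP k).1.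
have : m <= f z by apply: ge_inf => //; exists z.
have := (xP n).2; have := (xP k).2.
have : (0 : R) <= n.+1%:R^-1 by rewrite invr_ge0.
have : (0 : R) <= k.+1%:R^-1 by rewrite invr_ge0.
move: (_^-1) (_^-1) => p q; lra.
Qed.

Lemma cvgn_of_sqr_dist (H : completeNormedModType R) (C : R) (x : nat -> H) :
  (forall n k, `|x n - x k| ^+ 2 <= C * (n.+1%:R^-1 + k.+1%:R^-1)) -> cvgn x.
Proof.
move=> h; apply/cauchy_cvgP/cauchy_exP => e e0.
(* The sign of [C] is unknown, so [|C| + 1] serves as a positive upper bound that may be divided
   by. *)
have C1 : 0 < `|C| + 1 by rewrite ltr_wpDl.
have e2 : 0 < e ^+ 2 / (2 * (`|C| + 1)) by rewrite divr_gt0 ?exprn_gt0// mulr_gt0.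
have [N _ NP] := near_infty_natSinv_lt (PosNum e2).
exists (x N); exists N => // n /= Nn.
rewrite -ball_normE /= -(@ltr_pXn2r _ 2)// ?nnegrE ?(ltW e0)//.
apply: le_lt_trans (h _ _) _.
have sN := NP N (leqnn N); have sn := NP n Nn; rewrite /= in sN sn.
have s0 : 0 < N.+1%:R^-1 + n.+1%:R^-1 :> R by rewrite addr_gt0.
apply: (@le_lt_trans _ _ ((`|C| + 1) * (N.+1%:R^-1 + n.+1%:R^-1))).
  by rewrite ler_pM2r// (le_trans (ler_norm _))// lerDl.
rewrite mulrC -ltr_pdivlMr//; apply: lt_le_trans (ltrD sN sn) _.
by rewrite le_eqVlt; apply/orP; left; apply/eqP; field; rewrite gt_eqF.
Qed.

(** First-order condition: minimality along a segment, divided by the step [t], gives such a family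
    of inequalities, and [t] tends to 0. *)
Lemma ge0_of_affine_ge0 (c k : R) :
  (forall t, 0 < t -> t <= 1 -> 0 <= c + t * k) -> 0 <= c.
Proof.
move=> h; rewrite leNgt; apply/negP => c0.
have k1 : 0 < `|k| + 1 by rewrite ltr_wpDl.
(* For negative [c] this step makes [t * k] at most [- c / 2], so that [c + t * k] would still be
   negative. *)
pose t := Num.min 1 (- c / (2 * (`|k| + 1))).
have t0 : 0 < t by rewrite lt_min ltr01/= divr_gt0 ?oppr_gt0// mulr_gt0.
have t1 : t <= 1 by rewrite ge_min lexx.
have : t * (`|k| + 1) <= - c / 2.
  rewrite -ler_pdivlMr// -mulrA -invfM.
  by rewrite /t ge_min lexx orbT.
have := h t t0 t1.
have : t * k <= t * `|k| by rewrite ler_pM2l// ler_norm.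
rewrite mulrDr mulr1; lra.
Qed.
End minimisation.

(** * Riesz representation and Minty's theorem *)

Section hilbert.
Context {R : realType} {H : completeNormedModType R} {dot : {dot H for idfun}}.
Hypothesis dot_norm : induces_norm dot.

(** The representing vector is the minimiser of [|x| ^+ 2 / 2 - phi x]. By the parallelogram law the
    convexity gap of this function at midpoints is exactly [|x - y| ^+ 2 / 8]. *)
Lemma riesz (phi : H -> R) (C : R) :
  (forall a x y, phi (a *: x + y) = a * phi x + phi y) ->
  (forall x, `|phi x| <= C * `|x|) -> exists x, forall y, phi y = dot x y.
Proof.
move=> phiL phiC.
have phiD x y : phi (x + y) = phi x + phi y by rewrite -[x in LHS]scale1r phiL mul1r.
have phi0 : phi 0 = 0 by apply: (addrI (phi 0)); rewrite -phiD !addr0.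
have phiZ a x : phi (a *: x) = a * phi x by rewrite -[a *: x]addr0 phiL phi0 addr0.
pose g x := `|x| ^+ 2 / 2 - phi x.
have lb : has_lbound (g @` setT).
  exists (- (C ^+ 2 / 2)) => _ [x _ <-]; rewrite /g.
  have := sqr_ge0 (`|x| - C); have := le_trans (ler_norm _) (phiC x).
  nra.
have [||//|x _ [xm xc]] := @minimizing_sequence R H setT g (fun x y => `|x - y| ^+ 2 / 8).
- by exists 0.
- exact: lb.
- move=> x y _ _; exists (2^-1 *: (x + y)) => //.
  rewrite /g -!(dotxx dot_norm) phiZ phiD !dotE (dotC y x).
  rewrite le_eqVlt; apply/orP; left; apply/eqP.
  by field.
set m := inf _ in xm.
have /cvg_ex[l /= xl] : cvgn x.
  apply: (@cvgn_of_sqr_dist _ _ 8) => n k; rewrite -ler_pdivrMl// mulrC; exact: xc.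
have phil : phi (x n) @[n --> \oo] --> phi l.
  apply/cvgrPdist_le => e e0; have C1 : 0 < `|C| + 1 by rewrite ltr_wpDl.
  have /cvgrPdist_le/(_ (e / (`|C| + 1))) := xl; rewrite divr_gt0// => /(_ isT).
  apply: filterS => n h; have -> : phi l - phi (x n) = phi (l - x n).
    by rewrite -[X in phi (_ + X)]scaleN1r phiD phiZ mulN1r.
  apply: le_trans (phiC _) _; apply: (@le_trans _ _ ((`|C| + 1) * `|l - x n|)).
    by rewrite ler_wpM2r// (le_trans (ler_norm _))// lerDl.
  by rewrite mulrC -ler_pdivlMr.
have gl : g l <= m.
  apply: (@ler_cvg_to _ \oo _ R (g \o x) (fun n => m + n.+1%:R^-1)).
  - rewrite /g /comp /=; apply: (cvgB _ phil); apply: cvgM; last exact: cvg_cst.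
    exact: cvg_normsq.
  - by rewrite -[X in _ --> X]addr0; apply: cvgD; [exact: cvg_cst|exact: cvg_harmonic].
  - by apply: nearW => n; exact: xm.
exists l => y.
have gP z : g l <= g z by apply: le_trans gl _; apply: ge_inf => //; exists z.
(* First-order condition in the direction [z]; the directions [y] and [- y] together give
   equality. *)
have aff z : 0 <= dot l z - phi z.
  apply: (@ge0_of_affine_ge0 _ _ (dot z z / 2)) => t t0 t1.
  have := gP (l + t *: z).
  rewrite /g -!(dotxx dot_norm) phiD phiZ !dotE (dotC z l) -subr_ge0 => h.
  rewrite -(pmulr_rge0 _ t0); apply: le_trans h _.
  by rewrite le_eqVlt; apply/orP; left; apply/eqP; field.
apply/eqP; rewrite -subr_eq0 eq_le; have := aff y; have := aff (-1 *: y).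
rewrite phiZ !dotE; lra.
Qed.

Lemma minty (N : H -> set H) :
  monotone_op dot 0 N ->
  (forall x u, (forall y v, N y v -> 0 <= dot (x - y) (u - v)) -> N x u) ->
  exists x, N x (- x).
Proof.
move=> Nmono Nmax.
(* [S] is the epigraph of the Fitzpatrick function of [N]; the third coordinate stands for its
   value, which may be infinite. [g] adds half the squared norms, and [d] is the convexity gap of
   these squares. *)
pose S (p : H * H * R) := forall a b, N a b ->
  dot p.1.1 b + dot a p.1.2 - dot a b <= p.2.
pose g (p : H * H * R) := p.2 + (`|p.1.1| ^+ 2 + `|p.1.2| ^+ 2) / 2.
pose d (p q : H * H * R) :=
  (`|p.1.1 - q.1.1| ^+ 2 + `|p.1.2 - q.1.2| ^+ 2) / 8.
(* The Fitzpatrick function dominates the duality product: a pair violating this would be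
   monotonically related to the graph, hence in it, and testing [S] at the pair itself gives a
   contradiction. *)
have S_dot p : S p -> dot p.1.1 p.1.2 <= p.2.
  move=> Sp; rewrite leNgt; apply/negP => lt.
  have : N p.1.1 p.1.2.
    apply: Nmax => y v /Sp; rewrite !dotE; lra.
  by move=> /Sp; rewrite addrK leNgt lt.
have lb : has_lbound (g @` S).
  exists 0 => _ [p /S_dot Sp <-]; rewrite /g -!(dotxx dot_norm).
  have := dot_ge0 (p.1.1 + p.1.2) : 0 <= dot _ _.
  rewrite !dotE (dotC p.1.2 p.1.1); lra.
(* If the graph were empty, every pair would be vacuously related to it, so [(0, 0)] would belong to
   it. *)
have [a0 [b0 Nab0]] : exists a0 b0, N a0 b0.
  apply: contrapT => N0; apply: (N0); exists 0, 0; apply: Nmax => y v Nyv.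
  by case: N0; exists y, v.
have [||p q Sp Sq|x Sx [xm xc]] := @minimizing_sequence R _ S g d.
- exists (a0, b0, dot a0 b0) => a b Nab /=.
  have := Nmono _ _ _ _ Nab Nab0; rewrite mul0r !dotE; lra.
- exact: lb.
- exists (2^-1 *: (p.1.1 + q.1.1), 2^-1 *: (p.1.2 + q.1.2), (p.2 + q.2) / 2).
    move=> a b Nab /=; have := Sp _ _ Nab; have := Sq _ _ Nab.
    rewrite !dotE; lra.
  rewrite /g /d /= -!(dotxx dot_norm) !dotE (dotC q.1.1 p.1.1) (dotC q.1.2 p.1.2).
  by rewrite le_eqVlt; apply/orP; left; apply/eqP; field.
set m := inf _ in xm.
have /cvg_ex[l1 /= xl1] : cvgn (fun n => (x n).1.1).
  apply: (@cvgn_of_sqr_dist _ _ 8) => n k; rewrite -ler_pdivrMl// mulrC.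
  apply: le_trans (xc n k); rewrite /d ler_pM2r// lerDl; exact: sqr_ge0.
have /cvg_ex[l2 /= xl2] : cvgn (fun n => (x n).1.2).
  apply: (@cvgn_of_sqr_dist _ _ 8) => n k; rewrite -ler_pdivrMl// mulrC.
  apply: le_trans (xc n k); rewrite /d ler_pM2r// lerDr; exact: sqr_ge0.
(* The third coordinate for which [g (l1, l2, r)] equals the infimum [m]. *)
pose r := m - (`|l1| ^+ 2 + `|l2| ^+ 2) / 2.
have Sl : S (l1, l2, r).
  move=> a b Nab /=.
  apply: (@ler_cvg_to _ \oo _ R
    (fun n => dot (x n).1.1 b + dot a (x n).1.2 - dot a b)
    (fun n => m + n.+1%:R^-1 - (`|(x n).1.1| ^+ 2 + `|(x n).1.2| ^+ 2) / 2)).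
  - rewrite (dotC a l2); under eq_fun do rewrite (dotC a).
    apply: cvgB; last exact: cvg_cst.
    by apply: cvgD; apply: (cvg_dotr dot_norm).
  - apply: cvgB.
      by rewrite -[X in _ --> X]addr0; apply: cvgD; [exact: cvg_cst|exact: cvg_harmonic].
    apply: cvgM; last exact: cvg_cst.
    by apply: cvgD; [exact: (cvg_normsq xl1)|exact: (cvg_normsq xl2)].
  - apply: nearW => n; have := xm n; have := Sx n _ _ Nab; rewrite /g.
    set k := n.+1%:R^-1; lra.
(* First-order condition at the minimiser [(l1, l2, r)] towards [(a, b, dot a b)]. The latter point
   is in [S] by monotonicity, and [S] is convex. *)
have bracket a b : N a b ->
    0 <= dot a b - r + dot l1 (a - l1) + dot l2 (b - l2).
  move=> Nab.
  apply: (@ge0_of_affine_ge0 _ _ ((`|a - l1| ^+ 2 + `|b - l2| ^+ 2) / 2)) => t t0 t1.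
  have : m <= g (l1 + t *: (a - l1), l2 + t *: (b - l2), r + t * (dot a b - r)).
    apply: ge_inf => //; eexists; last reflexivity.
    move=> a' b' N' /=; have h1 := Sl _ _ N'; rewrite /= in h1.
    have := Nmono _ _ _ _ Nab N'; rewrite mul0r.
    rewrite !dotE => h2; rewrite /= in h1.
    have : 0 <= (1 - t) * (r - (dot l1 b' + dot a' l2 - dot a' b')).
      by rewrite mulr_ge0// subr_ge0.
    have := mulr_ge0 (ltW t0) h2; lra.
  rewrite /g /= /r -!(dotxx dot_norm) !dotE (dotC a l1) (dotC b l2) -subr_ge0 => h.
  rewrite -(pmulr_rge0 _ t0); apply: le_trans h _.
  by rewrite le_eqVlt; apply/orP; left; apply/eqP; field.
have rl : dot l1 l2 <= r by exact: (S_dot _ Sl).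
have key a b : N a b -> `|l1 + l2| ^+ 2 <= dot (a + l2) (b + l1).
  move=> /bracket; rewrite -(dotxx dot_norm) !dotE.
  rewrite (dotC l2 l1) (dotC a l1) (dotC l2 b) (dotC b l2); lra.
(* [key] says that this pair is monotonically related to the graph. Applying [key] to the pair
   itself then forces [|l1 + l2|] to vanish. *)
have Nl : N (- l2) (- l1).
  apply: Nmax => a b /key h; apply: le_trans (sqr_ge0 _) (le_trans h _).
  by rewrite -opprD -opprD dotNl dotNr opprK (addrC l2) (addrC l1).
have := key _ _ Nl; rewrite addNr dot0l => /(conj (sqr_ge0 `|l1 + l2|)) /andP.
rewrite -eq_le eq_sym sqrf_eq0 normr_eq0 addr_eq0 => /eqP l12.
by exists (- l2); rewrite -[in X in N _ X]l12.
Qed.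

End hilbert.

(** * Resolvents and the Douglas-Rachford operator *)

Section operators.
Context {R : realType} {H : completeNormedModType R} {dot : {dot H for idfun}}.
Hypothesis dot_norm : induces_norm dot.

(** Adjoining the single pair [(x, u)] to the graph would give an [alpha]-monotone operator,
    strictly larger if the pair were new. *)
Lemma max_monotone_mem alpha (A : H -> set H) x u :
  max_monotone_op dot alpha A ->
  (forall y v, A y v -> alpha * `|x - y| ^+ 2 <= dot (x - y) (u - v)) -> A x u.
Proof.
move=> [Amono Amax] h; apply: contrapT => NAxu; apply: Amax.
exists (fun y v => A y v \/ (y = x /\ v = u)).
  move=> y z v w [Ayv|[-> ->]] [Azw|[-> ->]].
  - exact: Amono.
  - by rewrite distrC -(opprB x) -(opprB u) dotNl dotNr opprK; exact: h.
  - exact: h.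
  - by rewrite !subrr dot0l normr0 expr0n mulr0.
split; first by move=> [y v]; left.
by move=> /(_ (x, u)) /= h'; apply: NAxu; apply: h'; right.
Qed.

(* Minty's theorem is applied to the maximally monotone operator
   [q |-> (gamma (A q - alpha q) - x) / (1 + gamma alpha)]. *)
Lemma resolvent_mem alpha gamma (A : H -> set H) x :
  max_monotone_op dot alpha A -> 0 < gamma -> 0 < 1 + gamma * alpha ->
  A (resolvent gamma A x) (gamma^-1 *: (x - resolvent gamma A x)).
Proof.
move=> Amax g0 c0; set c := 1 + gamma * alpha in c0.
suff : exists p, resolvent_set gamma A x p.
  move=> /(@xgetPex _ 0) px.
  have [a Ap pa] : exists2 a, A (resolvent gamma A x) a &
    resolvent gamma A x + gamma *: a = x := px.
  by rewrite -{2}pa addrAC subrr add0r scalerA mulVf ?gt_eqF// scale1r.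
pose N (q n : H) := A q (gamma^-1 *: (x + c *: n + (gamma * alpha) *: q)).
have [||q Nq] := @minty _ _ dot dot_norm N.
- move=> p q m n /Amax.1 h /h; rewrite mul0r -(dotxx dot_norm) => {}h.
  rewrite -(pmulr_rge0 _ c0); move: h; rewrite -(ler_pM2l g0) -subr_ge0 => h.
  apply: le_trans h _; rewrite /c !dotE le_eqVlt; apply/orP; left; apply/eqP.
  by field; rewrite gt_eqF.
- move=> p m h; apply: (max_monotone_mem Amax) => q v Aqv.
  have Nq : N q (c^-1 *: (gamma *: v - x - (gamma * alpha) *: q)).
    rewrite /N scalerA mulfV ?gt_eqF// scale1r.
    by rewrite -!addrA addNr addr0 addrC subrK scalerA mulVf ?gt_eqF// scale1r.
  have := h _ _ Nq; rewrite -(pmulr_rge0 _ c0) -(dotxx dot_norm) => {}h.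
  rewrite -(ler_pM2l g0) -subr_ge0.
  apply: le_trans h _; rewrite !dotE le_eqVlt; apply/orP; left; apply/eqP.
  by rewrite (dotC q p); field; rewrite !gt_eqF.
exists q, (gamma^-1 *: (x - q)).
  move: Nq; rewrite /N scalerN /c scalerDl scale1r opprD addrA.
  by rewrite subrK.
by rewrite scalerA mulfV ?gt_eqF// scale1r addrC subrK.
Qed.

Lemma resolvent_monotone alpha gamma (A : H -> set H) x y :
  max_monotone_op dot alpha A -> 0 < gamma -> 0 < 1 + gamma * alpha ->
  (1 + gamma * alpha) * `|resolvent gamma A x - resolvent gamma A y| ^+ 2 <=
  dot (resolvent gamma A x - resolvent gamma A y) (x - y).
Proof.
move=> Amax g0 c0; set J := resolvent gamma A.
have := Amax.1 _ _ _ _ (resolvent_mem x Amax g0 c0) (resolvent_mem y Amax g0 c0).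
rewrite -/J => h; rewrite -(ler_pM2l g0) -subr_ge0 in h.
rewrite -subr_ge0; apply: le_trans h _; rewrite -!(dotxx dot_norm) !dotE.
rewrite le_eqVlt; apply/orP; left; apply/eqP.
by field; rewrite gt_eqF.
Qed.

Lemma resolvent_lipschitz alpha gamma (A : H -> set H) x y :
  max_monotone_op dot alpha A -> 0 < gamma -> 0 < 1 + gamma * alpha ->
  (1 + gamma * alpha) * `|resolvent gamma A x - resolvent gamma A y| <= `|x - y|.
Proof.
move=> Amax g0 c0; set z := _ - _.
have [->|z0] := eqVneq z 0; first by rewrite normr0 mulr0.
have := le_trans (resolvent_monotone x y Amax g0 c0) (ler_dot dot_norm _ _).
by rewrite -/z expr2 mulrA [leRHS]mulrC ler_pM2r// normr_gt0.
Qed.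

(** Only negative [alpha] matters. Then [beta] is positive, and the hypothesis cleared of its
    denominator says that [(1 + gamma * alpha) * beta] exceeds [- alpha], which is positive. *)
Lemma resolvent_coef_gt0 (alpha beta gamma : R) :
  0 < gamma -> 0 < alpha + beta -> -1 < gamma * alpha * beta / (alpha + beta) ->
  0 < 1 + gamma * alpha.
Proof.
move=> g0 ab; rewrite ltr_pdivlMr// mulN1r => h.
have [a0|a0] := leP 0 alpha; first by rewrite ltr_wpDr// mulr_ge0// ltW.
have b0 : 0 < beta by lra.
rewrite ltNge; apply/negP => le0.
have : (1 + gamma * alpha) * beta <= 0 by rewrite mulr_le0_ge0// ltW.
lra.
Qed.

Section douglas_rachford.
Variables (A B : H -> set H) (alpha beta gamma epsilon : R).
Hypotheses (A_max : max_monotone_op dot alpha A)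
  (B_max : max_monotone_op dot beta B).
Hypotheses (gamma_gt0 : 0 < gamma) (epsilon_gt0 : 0 < epsilon)
  (alpha_beta : 0 < alpha + beta)
  (gamma_cond : epsilon - 1 < gamma * alpha * beta / (alpha + beta)).

Let JA := resolvent gamma A.
Let RA := relaxed_resolvent 2 gamma A.
Let JB := resolvent gamma B.
Let T x := relaxed_resolvent 2 gamma B (RA x).

Let cA : 0 < 1 + gamma * alpha.
Proof.
apply: (@resolvent_coef_gt0 _ beta) => //; move: gamma_cond epsilon_gt0; lra.
Qed.

Let cB : 0 < 1 + gamma * beta.
Proof.
apply: (@resolvent_coef_gt0 _ alpha) => //; first by rewrite addrC.
by rewrite mulrAC (addrC beta); move: gamma_cond epsilon_gt0; lra.
Qed.

Let RAE x : RA x = 2 *: JA x - x.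
Proof. by rewrite /RA /relaxed_resolvent (_ : 1 - 2 = -1) ?scaleN1r 1?addrC//; lra. Qed.

Lemma douglas_rachfordE x : x - T x = 2 *: (JA x - JB (RA x)).
Proof.
rewrite /T /relaxed_resolvent -/JB.
have -> : 1 - 2 = -1 :> R by lra.
rewrite scaleN1r RAE scalerBr; set r := JB _.
by rewrite opprD opprK addrA [x + _]addrC subrK.
Qed.

Lemma douglas_rachford_cocoercive x y :
  epsilon / 2 * `|(x - T x) - (y - T y)| ^+ 2 +
    2 * gamma / (alpha + beta) *
      `|alpha *: (JA x - JA y) + beta *: (JB (RA x) - JB (RA y))| ^+ 2 <=
  dot (x - y) ((x - T x) - (y - T y)).
Proof.
have hA := resolvent_monotone x y A_max gamma_gt0 cA.
have hB := resolvent_monotone (RA x) (RA y) B_max gamma_gt0 cB.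
rewrite /= -/JA in hA; rewrite /= -/JB in hB.
rewrite !douglas_rachfordE -scalerBr.
have RR : RA x - RA y = 2 *: (JA x - JA y) - (x - y).
  by rewrite !RAE scalerBr !opprB addrACA [RHS]addrACA [- x - _]addrC.
have -> : JA x - JB (RA x) - (JA y - JB (RA y)) = (JA x - JA y) - (JB (RA x) - JB (RA y)).
  by rewrite !opprB addrACA [RHS]addrACA [- _ - _]addrC.
move: hA hB; rewrite RR.
move: (JA x - JA y) (JB _ - JB _) (x - y) => P Q X.
rewrite -!(dotxx dot_norm) !dotE (dotC Q P) (dotC X P) (dotC X Q) => hA hB.
(* Adding [hA] and [hB] bounds [dot X (P - Q)] below by [|P - Q| ^+ 2] plus [gamma] times
   [alpha * |P| ^+ 2 + beta * |Q| ^+ 2]. The identity [E] splits the latter, and [gamma_cond] keeps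
   the resulting coefficient of [|P - Q| ^+ 2] large enough. *)
have e2 : epsilon / 2 * (2 * (2 * (dot P P - 2 * dot P Q + dot Q Q))) <=
   (1 + gamma * alpha * beta / (alpha + beta)) / 2 *
   (2 * (2 * (dot P P - 2 * dot P Q + dot Q Q))).
  apply: ler_wpM2r; last by move: gamma_cond; set k := _ / _; lra.
  have := dot_ge0 (P - Q) : 0 <= dot _ _.
  by rewrite !dotE (dotC Q P); lra.
have E : 2 * gamma / (alpha + beta) * (alpha ^+ 2 * dot P P +
     2 * alpha * beta * dot P Q + beta ^+ 2 * dot Q Q) =
   2 * gamma * (alpha * dot P P + beta * dot Q Q)
   - 2 * (gamma * alpha * beta / (alpha + beta)) *
    (dot P P - 2 * dot P Q + dot Q Q).
  by field; rewrite gt_eqF.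
lra.
Qed.

Lemma douglas_rachford_fix us : T us = us ->
  JA us = JB (RA us) /\ zer (add_op A B) = [set JA us].
Proof.
move=> Tus; have := douglas_rachfordE us; rewrite Tus subrr => /esym/eqP.
rewrite scaler_eq0 pnatr_eq0/= subr_eq0 => /eqP JAB; split => //.
have hA := resolvent_mem us A_max gamma_gt0 cA.
have hB := resolvent_mem (RA us) B_max gamma_gt0 cB.
rewrite -/JA in hA; rewrite -/JB -JAB RAE in hB.
set q := JA us in hA hB *.
(* As [RA us = 2 *: q - us], the elements of [A q] and [B q] produced by the two resolvents are
   opposite. *)
have z0 : add_op A B q 0.
  exists (gamma^-1 *: (us - q)) => //; eexists; first exact: hB.
  rewrite -scalerDr (_ : us - q + _ = 0) ?scaler0//.
  by rewrite scaler_nat mulr2n (addrAC (q + q)) addrK addrA subrK subrr.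
apply/seteqP; split => [p [a Aa [b Bb ab0]]|p ->//].
have [a' Aa' [b' Bb' ab0']] := z0.
(* Uniqueness: the two monotonicity inequalities add up to [(alpha + beta) * |p - q| ^+ 2 <= 0]. *)
have := A_max.1 _ _ _ _ Aa Aa'; have := B_max.1 _ _ _ _ Bb Bb'.
have -> : b = - a by apply/eqP; rewrite -addr_eq0 addrC ab0.
have -> : b' = - a' by apply/eqP; rewrite -addr_eq0 addrC ab0'.
rewrite !dotE => h1 h2.
have : (alpha + beta) * `|p - q| ^+ 2 <= 0 by move: h1 h2; lra.
rewrite pmulr_rle0// => h3.
apply/eqP; rewrite -subr_eq0 -normr_eq0 -sqrf_eq0 eq_le h3; exact: sqr_ge0.
Qed.

Lemma douglas_rachford_resolvent_continuous :
  continuous JA /\ continuous (JB \o RA).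
Proof.
have JC a C : max_monotone_op dot a C -> 0 < 1 + gamma * a ->
    continuous (resolvent gamma C).
  move=> Cmax c0 x; apply/cvgrPdist_le => e e0.
  near=> y; rewrite -(ler_pM2l c0).
  apply: le_trans (resolvent_lipschitz _ _ Cmax gamma_gt0 c0) _.
  near: y; move: {e0}(mulr_gt0 c0 e0); move: (_ * e) => d d0.
  by have /cvgrPdist_le := @cvg_id _ (nbhs x); exact.
split; first exact: (JC _ _ A_max cA).
move=> x; apply: continuous_comp; last exact: (JC _ _ B_max cB).
apply: cvgD; apply: cvgZ; try exact: cvg_cst; try exact: cvg_id.
exact: (JC _ _ A_max cA).
Unshelve. all: by end_near. Qed.

End douglas_rachford.
End operators.

(** * Absolutely continuous functions and Dini derivatives *)

Section real_induction.
Context {R : realType}.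

(** Let [s] be the supremum of the points up to which [P] holds. The limit clause gives [P s]; if
    [s < b], the step clause carries [P] beyond [s]. *)
Lemma real_induction (a b : R) (P : R -> Prop) : a <= b -> P a ->
  (forall x, a <= x -> x < b -> P x ->
    exists2 r, x < r & forall y, x < y -> y < r -> P y) ->
  (forall x, a < x -> x <= b -> (forall y, a <= y -> y < x -> P y) -> P x) ->
  P b.
Proof.
move=> ab Pa Pstep Plim.
pose S := [set x | a <= x <= b /\ forall y, a <= y -> y <= x -> P y].
have Sa : S a.
  by split=> [|y ay ya]; [rewrite lexx|have -> : y = a by apply/eqP; rewrite eq_le ay ya].
have supS : has_sup S by split; [exists a|exists b => x [/andP[]]].
pose s := sup S.
have as_ : a <= s by exact: ub_le_sup supS.2 _ Sa.
have sb : s <= b by apply: ge_sup; [exists a|move=> x [/andP[]]].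
have Pls y : a <= y -> y < s -> P y.
  move=> ay ys; have e0 : 0 < s - y by rewrite subr_gt0.
  have [x Sx] := sup_adherent e0 supS; rewrite -/s opprB addrCA subrr addr0 => yx.
  exact: Sx.2 (ltW yx).
have Ps : P s.
  by move: as_; rewrite le_eqVlt => /predU1P[<-//|as_]; exact: Plim.
move: (sb); rewrite le_eqVlt => /predU1P[<-//|ltsb].
have [r sr Pr] := Pstep s as_ ltsb Ps.
have sm : s < Num.min b r by rewrite lt_min ltsb sr.
suff : S ((s + Num.min b r) / 2).
  by move/(ub_le_sup supS.2); rewrite -/s leNgt (midf_lt sm).1.
have [h1 h2] := midf_lt sm.
split.
  by rewrite (le_trans as_ (ltW h1))/= (le_trans (ltW h2))// ge_min lexx.
move=> y ay ym; have [ys|sy|->//] := ltgtP y s; first exact: Pls.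
by apply: Pr => //; apply: le_lt_trans ym (lt_le_trans h2 _); rewrite ge_min lexx orbT.
Qed.

End real_induction.

Section ac.
Context {R : realType}.
Notation mu := (@lebesgue_measure R).

Lemma absolutely_continuous_within (V : normedModType R) (a b : R) (u : R -> V) :
  absolutely_continuous a b u ->
  forall e, 0 < e -> exists2 r, 0 < r & forall x y, a <= x -> x <= y -> y <= b ->
    y - x < r -> `|u y - u x| < e.
Proof.
move=> uac e e0; have [r r0 ur] := uac e e0; exists r => // x y ax xy yb yx.
have := ur 1%N (fun=> x) (fun=> y); rewrite !big_ord1; apply => //.
by move=> [[|//] ?] [[|//] ?] _ _ _; apply/val_inj.
Qed.

(* Real induction on [x]: the increment of [w] over [[a, x]] is controlled by
   [e * (x - a)], up to intervals inside an open set [U] of small measure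
   containing the exceptional null set, where absolute continuity applies. *)
Lemma ac_dini_nonincreasing (w : R -> R) (a b : R) : a <= b ->
  absolutely_continuous a b w ->
  {ae mu, forall t, a <= t -> t < b -> forall e, 0 < e ->
    \forall h \near 0^'+, w (t + h) <= w t + h * e} ->
  w b <= w a.
Proof.
move=> ab wac [N [mN N0 goodN]].
apply/ler_addgt0Pr => e' e'0.
(* Budget: [e * (b - a)] for the Dini bound, one [e] for the increments inside [U], and one for the
   slack [k]. *)
pose e := e' / (b - a + 2).
have ba2 : 0 < b - a + 2 by rewrite ltr_wpDl// subr_ge0.
have e0 : 0 < e by rewrite divr_gt0.
have [d d0 wd] := wac e e0.
have [|U [oU NU UN]] := lebesgue_regularity_outer mN _ d0.
  by rewrite [X in (X < _)%E]N0.
have mU : measurable U by exact: open_measurable.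
have Ud : (mu U < d%:E)%E.
  rewrite (measureDI mu mU mN) [X in (_ + X)%E](_ : _ = 0%E) ?adde0//.
  apply/eqP; rewrite eq_le measure_ge0 andbT -N0.
  by apply: le_measure; rewrite ?inE//; exact: measurableI.
pose P x := forall k, 0 < k -> exists n (c f : 'I_n -> R),
  [/\ forall i, [/\ a <= c i, c i <= f i & f i <= x],
      trivIset setT (fun i => `]c i, f i[%classic),
      forall i, `]c i, f i[ `<=` U &
      w x <= w a + e * (x - a) + \sum_(i < n) `|w (f i) - w (c i)| + k].
suff /(_ e e0) [n [c [f [cf tcf cfU]]]] : P b.
  have /wd : forall i, a <= c i /\ c i <= f i /\ f i <= b by move=> i; have [] := cf i.
  move=> /(_ tcf) wcf h; apply: le_trans h _.
  have : \sum_(i < n) (f i - c i) < d.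
    rewrite -lte_fin -sumEFin; apply: le_lt_trans Ud.
    rewrite [leLHS](_ : _ = \sum_(i < n) mu `]c i, f i[)%E; last first.
      apply: eq_bigr => i _; rewrite lebesgue_measure_itv/= lte_fin.
      have [_ + _] := cf i; rewrite le_eqVlt => /predU1P[->|->//].
      by rewrite ltxx subrr.
    rewrite -measure_bigsetU_ord//.
    apply: le_measure; rewrite ?inE//; first exact: bigsetU_measurable.
    by elim/big_ind: _ => // X Y XU YU; rewrite subUset.
  move=> /wcf; set s := \sum_(_ < _) _ => se.
  have : e * (b - a + 2) = e' by rewrite /e divfK// gt_eqF.
  lra.
apply: (@real_induction _ a b) => //.
- move=> k k0; exists 0%N, (fun=> 0), (fun=> 0); split=> [[]//|[]//|[]//|].
  by rewrite big_ord0 subrr mulr0 !addr0 lerDl ltW.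
- move=> x ax xb Px; have [Nx|Nx] := pselect (N x).
    have /nbhs_ballP[r/= r0 rU] := oU _ (NU _ Nx).
    exists (x + r) => [|y xy yr k k0]; first by rewrite ltrDl.
    have [n [c [f [cf tcf cfU wx]]]] := Px _ k0.
    (* At an exceptional point the interval []x, y[] lies in [U] and joins the list at index [ord0];
       the sum pays for its increment. *)
    exists n.+1, (fun i => oapp c x (unlift ord0 i)), (fun i => oapp f y (unlift ord0 i)).
    split.
    - move=> i; case: unliftP => [j|] _ /=; last by split=> //; exact: ltW.
      by have [h1 h2 h3] := cf j; split => //; apply: le_trans h3 (ltW xy).
    - move=> i j _ _; case: unliftP => [i' ->|->]; case: unliftP => [j' ->|->] //=
        [z [/=]].
      + by move=> h1 h2; congr lift; apply: tcf => //; exists z.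
      + have [_ _ h3] := cf i'; rewrite !in_itv/= => /andP[_ h1] /andP[h2 _].
        by have := lt_trans h2 (lt_le_trans h1 h3); rewrite ltxx.
      + have [_ _ h3] := cf j'; rewrite !in_itv/= => /andP[h2 _] /andP[_ h1].
        by have := lt_trans h2 (lt_le_trans h1 h3); rewrite ltxx.
    - move=> i; case: unliftP => [j|] _ /=; first exact: cfU.
      move=> z /=; rewrite in_itv/= => /andP[xz zy]; apply: rU.
      rewrite -ball_normE/= distrC ger0_norm ?subr_ge0 ?(ltW xz)// ltrBlDl.
      exact: lt_trans zy yr.
    - rewrite big_ord_recl unlift_none/=.
      under eq_bigr do rewrite liftK/=.
      have := ler_norm (w y - w x).
      have : 0 <= e * (y - x) by rewrite mulr_ge0 ?subr_ge0 ?ltW.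
      move: wx; set S := \sum_(_ < _) _; lra.
  have {Nx} : ~ ~ (a <= x -> x < b -> forall e, 0 < e ->
    \forall h \near 0^'+, w (x + h) <= w x + h * e) by move=> h; apply/Nx/goodN.
  move/contrapT => /(_ ax xb _ e0)[r/= r0 hr].
  exists (x + r) => [|y xy yr k k0]; first by rewrite ltrDl.
  have [n [c [f [cf tcf cfU wx]]]] := Px _ k0.
  exists n, c, f; split => //.
    by move=> i; have [h1 h2 h3] := cf i; split => //; apply: le_trans h3 (ltW xy).
  have := hr (y - x); rewrite /= sub0r normrN gtr0_norm subr_gt0// ltrBlDl => /(_ yr xy).
  rewrite addrCA subrr addr0; move: wx; set S := \sum_(_ < _) _; lra.
- move=> x ax xb Px k k0.
  have k2 : 0 < k / 2 by rewrite divr_gt0.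
  have [r r0 hr] := absolutely_continuous_within wac k2.
  (* A point so close to the left of [x] that the last increment of [w] is below [k / 2]; the slack
     [k] in [P] serves this limit step. *)
  pose y := Num.max a (x - r / 2).
  have ay : a <= y by rewrite le_max lexx.
  have yx : y < x by rewrite gt_max ax/= gtrDl oppr_lt0 divr_gt0.
  have [n [c [f [cf tcf cfU wx]]]] := Px _ ay yx _ k2.
  exists n, c, f; split => //.
    by move=> i; have [h1 h2 h3] := cf i; split => //; apply: le_trans h3 (ltW yx).
  have := hr y x ay (ltW yx) xb; have : x - r / 2 <= y by rewrite le_max lexx orbT.
  move=> h1 h2; have : x - y < r by move: h1 r0; lra.
  move=> /h2/ltW/(le_trans (ler_norm _)).
  have : 0 <= e * (x - y) by rewrite mulr_ge0 ?subr_ge0 ?ltW.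
  move: wx; set S := \sum_(_ < _) _; lra.
Qed.

Lemma derivable_right_approx (V : normedModType R) (u : R -> V) t :
  derivable u t 1 -> forall e, 0 < e ->
  \forall h \near 0^'+, `|u (t + h) - (u t + h *: u^`()%classic t)| <= h * e.
Proof.
move=> ud e e0; rewrite derive1E.
have /cvgrPdist_le/(_ _ e0)/nbhs_ballP[r/= r0 hr] :
  h^-1 *: (u (h *: 1 + t) - u t) @[h --> 0^'] --> 'D_1 u t := ud.
exists r => //= h hr' h0; have := hr _ hr' (lt0r_neq0 h0).
rewrite /= [h *: 1]mulr1 -(ler_pM2l h0) -{1}[h]ger0_norm ?(ltW h0)// -normrZ.
by rewrite scalerBr scalerA mulfV ?gt_eqF// scale1r distrC opprD addrA [h + t]addrC.
Qed.

Lemma absolutely_continuousB (V : normedModType R) (a b : R) (u v : R -> V) :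
  absolutely_continuous a b u -> absolutely_continuous a b v ->
  absolutely_continuous a b (fun t => u t - v t).
Proof.
move=> uac vac e e0; have e2 : 0 < e / 2 by rewrite divr_gt0.
have [r r0 ur] := uac _ e2; have [s s0 vs] := vac _ e2.
exists (Num.min r s) => [|n c d cd tcd]; first by rewrite lt_min r0.
rewrite lt_min => /andP[/(ur _ _ _ cd tcd) h1 /(vs _ _ _ cd tcd) h2].
rewrite (splitr e); apply: le_lt_trans (ltrD h1 h2).
rewrite -big_split/=; apply: ler_sum => i _.
apply: le_trans (ler_normB _ _); rewrite !opprB addrACA [in leRHS]addrACA.
by rewrite [- v _ - _]addrC.
Qed.

Lemma EFin_Rintegral (D : set R) (g : R -> R) : measurable D ->
  mu.-integrable D (EFin \o g) ->
  (\int[mu]_(x in D) g x)%:E = (\int[mu]_(x in D) (g x)%:E)%E.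
Proof. by move=> mD gi; rewrite /Rintegral fineK//; exact: integrable_fin_num. Qed.

Lemma absolutely_continuous_Rintegral (g : R -> R) (a b : R) :
  mu.-integrable setT (EFin \o g) ->
  absolutely_continuous a b (fun x => \int[mu]_(t in `[a, x]) g t).
Proof.
move=> gi e e0; have [r [r0 gr]] := integral_normr_continuous gi e0.
exists r => // n c d cd tcd cdr.
have giS (A : set R) : measurable A -> mu.-integrable A (EFin \o g).
  by move=> mA; apply: integrableS gi.
have giN (A : set R) : measurable A -> mu.-integrable A (EFin \o (fun x => `|g x|)).
  by move=> mA; exact: integrable_norm (giS _ mA).
pose D := \big[setU/set0]_(i < n) `]c i, d i[%classic.
have mD : measurable D by exact: bigsetU_measurable.
apply: le_lt_trans (gr D mD _); last first.
  rewrite /D measure_bigsetU_ord//; apply: le_lt_trans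
    (_ : (\sum_(i < n) (d i - c i))%:E < _)%E; last by rewrite lte_fin.
  rewrite -sumEFin; apply: lee_sum => i _.
  rewrite [leLHS](lebesgue_measure_itv `]c i, d i[)/=; case: ifPn => // _.
  by have [_ [h _]] := cd i; rewrite lee_fin subr_ge0.
have Dg : (\int[mu]_(x in D) `|g x|)%:E =
    (\sum_(i < n) \int[mu]_(x in `]c i, d i[) `|g x|%:E)%E.
  rewrite EFin_Rintegral//; last exact: giN.
  rewrite ge0_integral_bigsetU//=.
  - exact: index_enum_uniq.
  - by apply: sub_trivIset tcd.
  - by apply: measurable_funS (measurable_int _ (giN _ measurableT)).
rewrite -lee_fin Dg -sumEFin; apply: lee_sum => i _.
have [ac [cdi _]] := cd i.
rewrite Rintegral_itvB; last 3 first.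
- exact: giS.
- by rewrite bnd_simp.
- by rewrite bnd_simp.
rewrite -EFin_Rintegral ?lee_fin//; last exact: giN.
rewrite Rintegral_itv_bndo_bndc; last exact: giN.
by apply: le_normr_Rintegral => //; exact: giS.
Qed.

(** By Lebesgue differentiation the primitive of [g] has derivative [g] almost everywhere, so [v]
    minus this primitive falls under the nonincreasing case. *)
Lemma ac_dini_le (v g : R -> R) (a b : R) : a <= b ->
  absolutely_continuous a b v -> mu.-integrable `[a, b] (EFin \o g) ->
  {ae mu, forall t, a <= t -> t < b -> forall e, 0 < e ->
    \forall h \near 0^'+, v (t + h) <= v t + h * (g t + e)} ->
  v b - v a <= \int[mu]_(t in `[a, b]) g t.
Proof.
move=> ab vac gi vg; pose g0 := g \_ `[a, b].
have g0i : mu.-integrable setT (EFin \o g0).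
  by rewrite -restrict_EFin; apply/integrable_restrict => //=; rewrite setTI.
pose F x := \int[mu]_(t in `[a, x]) g0 t.
have Fa : F a = 0 by rewrite /F set_itv1 Rintegral_set1.
have -> : \int[mu]_(t in `[a, b]) g t = F b.
  by apply: eq_Rintegral => x xab; rewrite /g0 patchE xab.
suff : v b - F b <= v a - F a by rewrite Fa; lra.
apply: (ac_dini_nonincreasing ab (w := fun x => v x - F x)).
  by apply: absolutely_continuousB vac _; exact: absolutely_continuous_Rintegral.
have lg : locally_integrable [set: R] g0.
  by apply: integrable_locally.
have gy y : mu.-integrable [set` Interval (BLeft a) (BRight y)] (EFin \o g0).
  by apply: integrableS g0i.
have FTC := FTC1 gy lg.
have ta : {ae mu, forall t : R, t != a}.
  exists [set a]; split; [exact: measurable_set1|exact: lebesgue_measure_set1|].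
  by move=> t /= /negP; rewrite negbK => /eqP.
apply: (@filterS3 _ _ (ae_filter_ringOfSetsType mu) _ _ _ _ _ vg FTC ta).
move=> t vt Ft {}ta at_ tb e e0.
have e2 : 0 < e / 2 by rewrite divr_gt0.
have [|] := Ft; first by rewrite lte_fin lt_neqAle eq_sym ta.
rewrite -/F => Fd F't.
have g0t : g0 t = g t by rewrite /g0 patchE mem_set//= in_itv/= at_ ltW.
have := vt at_ tb _ e2.
have : \forall h \near 0^'+, F t + h * (g t - e / 2) <= F (t + h).
  have := derivable_right_approx Fd e2; rewrite F't g0t.
  apply: filterS => h; rewrite distrC => /(le_trans (ler_norm _)).
  by rewrite /GRing.scale/=; lra.
apply: filterS2 => h /=; lra.
Qed.

End ac.

(** * A Borel representative of the norm of an integrable function *)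

Section L1_majorant.
Context {R : realType} {V : normedModType R}.
Notation mu := (@lebesgue_measure R).

Lemma measurable_norm_simple_fun (s : R -> V) :
  simple_fun s -> measurable_fun setT (fun t => `|s t|).
Proof.
move=> [sfin smes] _ B mB; rewrite setTI.
have -> : (fun t => `|s t|) @^-1` B =
    \bigcup_(c in [set c | range s c /\ B `|c|]) s @^-1` [set c].
  apply/seteqP; split => [t Bt|t [c [_ Bc] /= stc]] /=; last by rewrite stc.
  by exists (s t) => //; split => //; exists t.
apply: fin_bigcup_measurable => [|c _]; last exact: smes.
by apply: sub_finite_set sfin => c [].
Qed.

(* [`|f|] itself need not be Borel measurable. *)
Lemma L1_norm_ae_eq (D : set R) (f : R -> V) : measurable D -> L1 D f ->
  exists g : R -> R, [/\ forall t, 0 <= g t, mu.-integrable D (EFin \o g) &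
    {ae mu, forall t, D t -> g t = `|f t|}].
Proof.
move=> mD [[s ssimple [N [mN N0 sf]]] fint].
(* Set to 0 on the null set [N], the norm becomes a pointwise limit of Borel functions
   everywhere. *)
pose g t := if t \in D `\` N then `|f t| else 0.
have gE t : D t -> ~ N t -> g t = `|f t|.
  by move=> Dt Nt; rewrite /g mem_set.
have g0 t : 0 <= g t by rewrite /g; case: ifP.
have mg : measurable_fun setT g.
  apply: (@measurable_fun_cvg _ _ _ setT
     (fun n t => `|s n t| * \1_(D `\` N) t)).
    move=> n; apply: measurable_funM; first exact: measurable_norm_simple_fun.
    by apply: measurable_indic; exact: measurableD.
  move=> t _; rewrite /g indicE; case: ifPn => /=; last first.
    by rewrite notin_setE => h; under eq_fun do rewrite mulr0; exact: cvg_cst.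
  rewrite inE => -[Dt Nt]; under eq_fun do rewrite mulr1.
  apply: cvg_norm; apply: contrapT => h; apply: Nt; apply: sf => /= h'.
  by apply: h; exact: h'.
exists g; split => //.
  apply/integrableP; split; first exact/measurable_EFinP/measurable_funTS.
  (* Both integrals are suprema over simple functions, and one lying below [g] also lies below
     [|f|]; no measurability of [|f|] enters. *)
  apply: le_lt_trans fint; rewrite !ge0_integralE//.
  apply: ge_ereal_sup => _ [h hg <-]; apply: ereal_sup_ubound; exists h => //.
  move=> x; apply: le_trans (hg x) _; rewrite !patchE; case: ifPn => // _ /=.
  by rewrite lee_fin ger0_norm// /g; case: ifP.
exists N; split => // t /= h; apply: contrapT => Nt; apply: h => Dt; exact: gE.
Qed.

End L1_majorant.

(** * Weak convergence *)

Lemma ler_cvg (R : realFieldType) (I : Type) (G : set_system I)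
    (f g : I -> R) (l l' : R) :
  ProperFilter G -> f i @[i --> G] --> l -> g i @[i --> G] --> l' ->
  (forall i, f i <= g i) -> l <= l'.
Proof.
move=> GP fl gl fg; rewrite -subr_ge0; apply: (cvgr_to_ge (cvgB gl fl)).
by apply: nearW => i; rewrite subr_ge0.
Qed.

Section weak_convergence.
Context {R : realType} {H : completeNormedModType R} {dot : {dot H for idfun}}.
Hypothesis dot_norm : induces_norm dot.

Lemma ultra_fmap (I U : Type) (f : I -> U) (G : set_system I) :
  UltraFilter G -> UltraFilter (f @ G).
Proof.
move=> GU; split=> [|K KP fGK]; first exact: fmap_proper_filter.
apply/seteqP; split=> // A KA; have [//|Gn] := in_ultra_setVsetC (f @^-1` A) GU.
have KnA : K (~` A) by apply: fGK.
by case: (@filter_not_empty _ K KP); rewrite -(setICr A); exact: filterI.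
Qed.

Lemma ultra_cvg_bounded (I : Type) (G : set_system I) (f : I -> R) (M : R) :
  UltraFilter G -> (\forall i \near G, `|f i| <= M) ->
  exists l : R, f i @[i --> G] --> l.
Proof.
move=> GU fM.
have := @segment_compact R (- M) M; rewrite compact_ultra.
move=> /(_ (f @ G) (ultra_fmap f GU)).
case=> [|l [_ fl]]; last by exists l.
by apply: filterS fM => i; rewrite /= in_itv/= ler_norml.
Qed.

(** Along an ultrafilter each bounded [dot (u i) y] converges; the limit is a bounded linear
    functional of [y], and Riesz provides its vector. *)
Lemma ultra_weak_cvg (I : Type) (G : set_system I) (u : I -> H) (M : R) :
  UltraFilter G -> (\forall i \near G, `|u i| <= M) ->
  exists x, weak_cvg dot G u x.
Proof.
move=> GU uM.
have uMy y : \forall i \near G, `|dot (u i) y| <= M * `|y|.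
  apply: filterS uM => i h; apply: le_trans (cauchy_schwarz dot_norm _ _) _.
  by rewrite ler_wpM2r.
have /choice[phi phiP] y := ultra_cvg_bounded GU (uMy y).
have [||x xP] := @riesz _ _ _ dot_norm phi M.
- move=> a x y; have GP : ProperFilter G by exact: ultra_proper.
  apply: (@cvg_unique _ (@Rhausdorff R) _ _ _ _ (phiP (a *: x + y))).
  rewrite /=;  under eq_fun do rewrite dotDr dotZr.
  by apply: cvgD; [apply: cvgM; [exact: cvg_cst|exact: phiP]|exact: phiP].
- move=> x; have GP : ProperFilter G by exact: ultra_proper.
  exact: (cvgr_to_le (cvg_norm (phiP x)) (uMy x)).
exists x => y; rewrite -xP; exact: phiP.
Qed.

Lemma cocoercive_lipschitz (F : H -> H) (kappa : R) :
  (forall x y, kappa * `|F x - F y| ^+ 2 <= dot (x - y) (F x - F y)) ->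
  forall x y, kappa * `|F x - F y| <= `|x - y|.
Proof.
move=> Fco x y; have [->|Fxy] := eqVneq (F x - F y) 0.
  by rewrite normr0 mulr0.
have := le_trans (Fco x y) (ler_dot dot_norm _ _).
by rewrite expr2 mulrA ler_pM2r// normr_gt0.
Qed.

Lemma opial_weak_cvg (I : Type) (E : set_system I) (F : H -> H) (kappa : R)
    (u : I -> H) (M : R) :
  ProperFilter E -> 0 < kappa ->
  (forall x y, kappa * `|F x - F y| ^+ 2 <= dot (x - y) (F x - F y)) ->
  (\forall i \near E, `|u i| <= M) ->
  F (u i) @[i --> E] --> 0 ->
  (forall z, F z = 0 -> cvg (`|u i - z| @[i --> E])) ->
  exists2 x, F x = 0 & weak_cvg dot E u x.
Proof.
move=> EP k0 Fco uM Fu0 uz.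
have Flip := cocoercive_lipschitz Fco.
have zeroP G x : UltraFilter G -> E `<=` G -> weak_cvg dot G u x -> F x = 0.
  move=> GU EG ux.
  have key y : dot (x - y) (F y) <= 0.
    have GP : ProperFilter G by exact: ultra_proper.
    have Fu0G : F (u i) @[i --> G] --> 0 by move=> W /Fu0; exact: EG.
    have uF : dot (u i - y) (F (u i)) @[i --> G] --> (0 : R).
      apply/cvgrPdist_le => e e0.
      have M1 : 0 < `|M| + `|y| + 1 by rewrite ltr_wpDl// addr_ge0.
      have /cvgrPdist_le/(_ (e / (`|M| + `|y| + 1))) := Fu0G.
      rewrite divr_gt0// => /(_ isT); apply: filterS2 (EG _ uM) => i uiM.
      rewrite !sub0r !normrN => Fui; apply: le_trans (cauchy_schwarz dot_norm _ _) _.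
      rewrite -(@divfK _ (`|M| + `|y| + 1) _ e) ?gt_eqF// mulrC; apply: ler_pM => //.
      apply: le_trans (ler_normB _ _) _; have := ler_norm M; lra.
    have uyF : dot (u i - y) (F y) @[i --> G] --> dot (x - y) (F y).
      under eq_fun do rewrite dotDl; rewrite dotDl.
      by apply: cvgD; [exact: ux|exact: cvg_cst].
    apply: (ler_cvg GP uyF uF) => i.
    have := le_trans (mulr_ge0 (ltW k0) (sqr_ge0 _)) (Fco (u i) y).
    by rewrite dotDr dotNr subr_ge0.
  (* Minty's trick with a finite step: for this point [y], [key] gives [dot (F x) (F y) <= 0], while
     the Lipschitz bound gives [|F x - F y| <= |F x| / 2]. Hence [|F x| ^+ 2] is at most half of
     itself. *)
  have := key (x - (kappa / 2) *: F x).
  rewrite opprB addrC subrK dotZl pmulr_rle0 ?divr_gt0//.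
  set y := x - _ => h.
  have : kappa * `|F x - F y| <= kappa / 2 * `|F x|.
    apply: le_trans (Flip x y) _.
    by rewrite /y opprB addrC subrK normrZ gtr0_norm ?divr_gt0.
  rewrite -mulrA ler_pM2l// => FxFy.
  have : `|F x| ^+ 2 <= `|F x| * (2^-1 * `|F x|).
    have := le_trans (ler_dot dot_norm _ _) (ler_wpM2l (normr_ge0 (F x)) FxFy).
    by apply: le_trans; rewrite dotDr dotNr (dotxx dot_norm) lerDl oppr_ge0.
  have := sqr_ge0 `|F x|; rewrite mulrCA -expr2 => h1 h2.
  by apply/eqP; rewrite -normr_eq0 -sqrf_eq0; apply/eqP; lra.
have uniq x y G K : UltraFilter G -> UltraFilter K -> E `<=` G -> E `<=` K ->
    weak_cvg dot G u x -> weak_cvg dot K u y -> x = y.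
  move=> GU KU EG EK ux uy.
  have Fx := zeroP _ _ GU EG ux; have Fy := zeroP _ _ KU EK uy.
  (* Opial: [|u i - x| ^+ 2 - |u i - y| ^+ 2] is an affine function of [dot (u i) (x - y)], so the
     latter converges along [E] and has the same limit along [G] and [K]. *)
  have [l ul] : exists l : R, dot (u i) (x - y) @[i --> E] --> l.
    have /cvg_ex[lx /= uxl] := uz x Fx; have /cvg_ex[ly /= uyl] := uz y Fy.
    exists ((lx ^+ 2 - ly ^+ 2 - (`|x| ^+ 2 - `|y| ^+ 2)) / - 2).
    rewrite (_ : (fun i => dot (u i) (x - y)) = fun i =>
      (`|u i - x| ^+ 2 - `|u i - y| ^+ 2 - (`|x| ^+ 2 - `|y| ^+ 2)) / - 2).
      apply: cvgM; last exact: cvg_cst.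
      apply: cvgB; last exact: cvg_cst.
      by apply: cvgB; rewrite !expr2; apply: cvgM.
    apply/funext => i; rewrite -!(dotxx dot_norm) !dotE (dotC x (u i)) (dotC y (u i)).
    by field.
  have /eqP : dot x (x - y) = dot y (x - y).
    have GP : ProperFilter G by exact: ultra_proper.
    have KP : ProperFilter K by exact: ultra_proper.
    rewrite (cvg_unique (@Rhausdorff R) (ux _) (_ : _ --> l)) => [|W /ul]; last exact: EG.
    by rewrite (cvg_unique (@Rhausdorff R) (uy _) (_ : _ --> l)) => [|W /ul];
      last exact: EK.
  rewrite -subr_eq0 -dotNl -dotDl (dotxx dot_norm) sqrf_eq0 normr_eq0 subr_eq0.
  by move/eqP.
have wex G : UltraFilter G -> E `<=` G -> exists x, weak_cvg dot G u x.
  by move=> GU EG; apply: (@ultra_weak_cvg _ _ _ M) => //; exact: EG.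
have [G [GU EG]] := ultraFilterLemma EP.
have [x ux] := wex G GU EG.
exists x; first exact: zeroP ux.
move=> y W Wxy; apply: contrapT => nE.
(* If convergence failed at [W], the trace of [E] on the bad set [D] would be proper. An ultrafilter
   refining it has the same weak limit [x], so it contains both [D] and its complement. *)
pose D : set I := ~` ((fun i => dot (u i) y) @^-1` W).
have DP : ProperFilter (within D E).
  split=> [h|]; last exact: within_filter.
  apply: nE; apply: (@filterS _ E _ _ _ _ h) => i Di.
  by apply: contrapT => /Di.
have [K [KU DK]] := ultraFilterLemma DP.
have EK : E `<=` K by move=> A EA; apply: DK; apply: filterS EA => i.
have [x' ux'] := wex K KU EK.
have xx' := uniq _ _ _ _ GU KU EG EK ux ux'.
have := ux' y W; rewrite -xx' => /(_ Wxy) KW.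
have KD : K D by apply: DK; exact: (@filterE _ E _ _ (fun i (h : D i) => h)).
have KP : ProperFilter K by exact: ultra_proper.
case: (@filter_not_empty _ K KP).
by rewrite -(setICr ((fun i => dot (u i) y) @^-1` W)); exact: filterI.
Qed.

End weak_convergence.

Section absolutely_continuous_extra.
Context {R : realType} {V W : normedModType R}.

Lemma absolutely_continuousS (a b c d : R) (u : R -> V) : a <= c -> d <= b ->
  absolutely_continuous a b u -> absolutely_continuous c d u.
Proof.
move=> ac db uac e /uac[r r0 h]; exists r => // n s t st; apply: h => i.
have [cs [-> td]] := st i.
by split; [exact: le_trans ac cs|split=> //; exact: le_trans td db].
Qed.

Lemma absolutely_continuous_lip (a b C : R) (u : R -> V) (v : R -> W) :
  (forall x y, a <= x -> x <= y -> y <= b -> `|v y - v x| <= C * `|u y - u x|) ->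
  absolutely_continuous a b u -> absolutely_continuous a b v.
Proof.
move=> vu uac e e0.
have C1 : 0 < `|C| + 1 by rewrite ltr_wpDl.
have [|r r0 h] := uac (e / (`|C| + 1)); first by rewrite divr_gt0.
exists r => // n s t st tst str; have := h _ _ _ st tst str.
rewrite ltr_pdivlMr// mulrC mulr_sumr; apply: le_lt_trans.
apply: ler_sum => i _; have [as_ [st_ tb]] := st i.
apply: le_trans (vu _ _ as_ st_ tb) _; apply: ler_wpM2r => //.
by apply: le_trans (ler_norm C) _; rewrite lerDl.
Qed.

Lemma absolutely_continuous_continuous (a b : R) (u : R -> V) :
  absolutely_continuous a b u -> {within `[a, b], continuous u}.
Proof.
move=> uac; apply/subspace_continuousP => x /=; rewrite in_itv/= => /andP[ax xb].
apply/cvgrPdist_lt => e e0; have [r r0 h] := absolutely_continuous_within uac e0.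
exists r => //= y; rewrite in_itv/= => xyr /andP[ay yb].
have [xy|/ltW yx] := leP x y.
  rewrite distrC; apply: h => //; apply: le_lt_trans xyr.
  by rewrite distrC ler_norm.
by apply: h => //; apply: le_lt_trans xyr; rewrite ler_norm.
Qed.

End absolutely_continuous_extra.

(** * Integrals and limits on a half-line *)

Section half_line.
Context {R : realType}.
Notation mu := (@lebesgue_measure R).

Lemma Rintegral_subset (A B : set R) (g : R -> R) :
  measurable A -> measurable B -> A `<=` B ->
  mu.-integrable B (EFin \o g) -> (forall t, B t -> 0 <= g t) ->
  \int[mu]_(t in A) g t <= \int[mu]_(t in B) g t.
Proof.
move=> mA mB AB gB g0; rewrite -lee_fin !EFin_Rintegral//; last exact: integrableS gB.
apply: ge0_subset_integral => //; exact: measurable_int gB.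
Qed.

Lemma nondecreasing_cvgr_from (t0 M : R) (v : R -> R) :
  (forall s t, t0 <= s -> s <= t -> v s <= v t) -> (forall t, t0 <= t -> v t <= M) ->
  cvg (v t @[t --> +oo]).
Proof.
move=> vnd vM; pose w t := v (Num.max t0 t).
have w_cvg : w t @[t --> +oo] --> sup (range w).
  apply: nondecreasing_cvgr => [x y xy|]; last first.
    by exists M => _ [x _ <-]; apply: vM; rewrite le_max lexx.
  apply: vnd; first by rewrite le_max lexx.
  by rewrite ge_max !le_max lexx/= xy orbT.
apply/cvg_ex; exists (sup (range w)); apply: cvg_trans w_cvg; apply: near_eq_cvg.
near=> t; rewrite /w max_r//; near: t; apply: nbhs_pinfty_ge; exact: num_real.
Unshelve. all: by end_near. Qed.

Section perturbed.
Variables (t0 : R) (g : R -> R).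
Hypotheses (g_ge0 : forall t, 0 <= g t)
  (g_int : mu.-integrable `[t0, +oo[ (EFin \o g)).

Lemma integrable_itv s t : t0 <= s -> mu.-integrable `[s, t] (EFin \o g).
Proof.
move=> ts; apply: integrableS g_int => //.
by apply: subset_itv; rewrite bnd_simp.
Qed.

Lemma Rintegral_itv_le s t : t0 <= s ->
  \int[mu]_(x in `[s, t]) g x <= \int[mu]_(x in `[t0, +oo[) g x.
Proof.
move=> ts; apply: Rintegral_subset => //.
by apply: subset_itv; rewrite bnd_simp.
Qed.

Lemma Rintegral_itv_split s t : t0 <= s -> s <= t ->
  \int[mu]_(x in `[s, t]) g x =
  \int[mu]_(x in `[t0, t]) g x - \int[mu]_(x in `[t0, s]) g x.
Proof.
move=> ts st; rewrite Rintegral_itvB ?bnd_simp//; last exact: integrable_itv.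
rewrite Rintegral_itv_obnd_cbnd//.
by apply: integrableS (integrable_itv t ts) => //; apply: subset_itv; rewrite bnd_simp.
Qed.

Variables (v : R -> R) (C : R).
Hypotheses (C_ge0 : 0 <= C)
  (v_le : forall s t, t0 <= s -> s <= t ->
    v t <= v s + C * \int[mu]_(x in `[s, t]) g x)
  (v_ge0 : forall t, t0 <= t -> 0 <= v t).

(** [C] times the primitive of [g], minus [v], is nondecreasing and bounded, and the primitive
    itself converges. *)
Lemma perturbed_nonincreasing_cvg : cvg (v t @[t --> +oo]).
Proof.
pose I t := \int[mu]_(x in `[t0, t]) g x.
pose K := \int[mu]_(x in `[t0, +oo[) g x.
have /cvg_ex[l Il] : cvg (I t @[t --> +oo]).
  apply: (@nondecreasing_cvgr_from t0 K) => [s t ts st|t _].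
    by rewrite -subr_ge0 -Rintegral_itv_split// Rintegral_ge0.
  exact: Rintegral_itv_le.
have /cvg_ex[m vm] : cvg (C * I t - v t @[t --> +oo]).
  apply: (@nondecreasing_cvgr_from t0 (C * K)) => [s t ts st|t tt].
    have := v_le ts st; rewrite Rintegral_itv_split// -/(I t) -/(I s); lra.
  have := v_ge0 tt; have := ler_wpM2l C_ge0 (Rintegral_itv_le t (lexx t0)).
  by rewrite -/(I t) -/K; lra.
apply/cvg_ex; exists (C * l - m).
have -> : v = fun t => C * I t - (C * I t - v t).
  by apply/funext => t; rewrite opprB addrC subrK.
by apply: cvgB vm; apply: cvgM Il; exact: cvg_cst.
Qed.

Lemma perturbed_nonincreasing_cvg0 (K : R) :
  (forall t, mu.-integrable `[t0, t] (fun s => (v s ^+ 2)%:E)) ->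
  (forall t, t0 <= t -> \int[mu]_(s in `[t0, t]) (v s ^+ 2) <= K) ->
  v t @[t --> +oo] --> (0 : R).
Proof.
move=> vi vK; have /cvg_ex[l vl] := perturbed_nonincreasing_cvg.
have l0 : 0 <= l.
  apply: (cvgr_to_ge vl); near=> t; apply: v_ge0; near: t.
  by apply: nbhs_pinfty_ge; exact: num_real.
move: l0; rewrite le_eqVlt => /predU1P[l0|l0]; first by rewrite [X in _ --> X]l0.
exfalso.
have l2 : l / 2 < l by rewrite ltr_pdivrMr// ltr_pMr// ltr1n.
have [S [_ vS]] : \forall t \near +oo, l / 2 < v t by exact: (cvgr_gt _ vl).
pose S' := Num.max t0 (S + 1).
have tS : t0 <= S' by rewrite le_max lexx.
have SS : S < S' by rewrite lt_max ltrDl ltr01 orbT.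
have l4 : 0 < (l / 2) ^+ 2 by rewrite exprn_gt0// divr_gt0.
(* If the limit [l] were positive, [v] would eventually exceed [l / 2]; over an interval of this
   length the integral of [v ^+ 2] would reach [|K| + 1]. *)
pose len := (`|K| + 1) / (l / 2) ^+ 2.
have len0 : 0 < len by rewrite divr_gt0// ltr_wpDl.
have SL : S' <= S' + len by rewrite lerDl ltW.
have : \int[mu]_(x in `[S', S' + len]) ((l / 2) ^+ 2) <= K.
  apply: le_trans (vK (S' + len) (le_trans tS SL)).
  apply: (@le_trans _ _ (\int[mu]_(x in `[S', S' + len]) (v x ^+ 2))).
    apply: le_Rintegral => //.
    - apply: continuous_compact_integrable; first exact: segment_compact.
      by apply: continuous_subspaceT => x; exact: cvg_cst.
    - by apply: integrableS (vi (S' + len)) => //; apply: subset_itv; rewrite bnd_simp.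
    - move=> x /=; rewrite in_itv/= => /andP[Sx _].
      rewrite ler_pXn2r ?nnegrE ?divr_ge0 ?(ltW l0)//; last first.
        by rewrite v_ge0// (le_trans tS Sx).
      by apply/ltW/vS/(lt_le_trans SS Sx).
  apply: Rintegral_subset => //; last by move=> t _; exact: sqr_ge0.
  by apply: subset_itv; rewrite bnd_simp.
rewrite Rintegral_cst//.
rewrite [X in fine X](_ : _ = len%:E); last first.
  rewrite [LHS](lebesgue_measure_itv `[S', S' + len])/= lte_fin ltrDl len0.
  by rewrite EFinN -EFinD addrAC subrr add0r.
rewrite /len/= mulrC divfK ?gt_eqF//.
have := ler_norm K; lra.
Unshelve. all: by end_near. Qed.

End perturbed.

(** Monotone convergence along the exhaustion by [E n], which also supplies measurability. *)
Lemma integrable_half_line (t0 K : R) (h : R -> R) : (forall t, 0 <= h t) ->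
  (forall t, mu.-integrable `[t0, t] (EFin \o h)) ->
  (forall t, t0 <= t -> \int[mu]_(s in `[t0, t]) h s <= K) ->
  mu.-integrable `[t0, +oo[ (EFin \o h).
Proof.
move=> h0 hi hK; pose E (n : nat) : set R := `[t0, t0 + n%:R]%classic.
have EE : `[t0, +oo[%classic = \bigcup_n E n.
  apply/seteqP; split => [t /=|t [n _]]; rewrite /E /= !in_itv/=; last by case/andP=> ->.
  rewrite andbT => t0t; exists (Num.truncn (t - t0)).+1 => //=.
  rewrite in_itv/= t0t/= -lerBlDl; apply: ltW; exact: truncnS_gt.
have mE (n : nat) : measurable (E n) by apply: measurable_itv.
have mh : measurable_fun `[t0, +oo[ (EFin \o h).
  by rewrite EE; apply/measurable_fun_bigcup => // n; exact: measurable_int (hi _).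
apply/integrableP; split => //.
have -> : (\int[mu]_(x in `[t0, +oo[) `|(EFin \o h) x| =
    \int[mu]_(x in `[t0, +oo[) (EFin \o h) x)%E.
  by apply: eq_integral => x _; rewrite gee0_abs// lee_fin.
apply: (@le_lt_trans _ _ K%:E); last exact: ltry.
rewrite EE; apply: (cvge_to_le (ge0_nondecreasing_set_cvg_integral _ _ _ _)) => //.
- move=> m n mn; apply/subsetPset; apply: subset_itv; rewrite bnd_simp//.
  by rewrite lerD2l ler_nat.
- by move=> n; exact: measurable_int (hi _).
- by move=> n x _; rewrite lee_fin.
- apply: nearW => n; rewrite -EFin_Rintegral//; last exact: hi.
  by rewrite lee_fin hK// lerDl.
Qed.

End half_line.

(** * The perturbed flow of a cocoercive operator *)

Lemma integrable_EFinZl (R : realType) (D : set R) (k : R) (h : R -> R) :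
  measurable D -> (@lebesgue_measure R).-integrable D (EFin \o h) ->
  (@lebesgue_measure R).-integrable D (EFin \o (fun x => k * h x)).
Proof.
move=> mD hi; have := @integrableZl _ _ _ (@lebesgue_measure R) D mD k _ hi.
by apply: eq_integrable => // x _; rewrite /= EFinM.
Qed.

Section flow.
Context {R : realType} {H : completeNormedModType R} {dot : {dot H for idfun}}.
Hypothesis dot_norm : induces_norm dot.
Notation mu := (@lebesgue_measure R).

Variables (F : H -> H) (kappa : R).
Hypotheses (kappa_gt0 : 0 < kappa)
  (F_coco : forall x y, kappa * `|F x - F y| ^+ 2 <= dot (x - y) (F x - F y)).

Lemma cocoercive_continuous : continuous F.
Proof.
move=> x; apply/cvgrPdist_le => e e0.
near=> y; rewrite -(ler_pM2l kappa_gt0).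
apply: le_trans (cocoercive_lipschitz dot_norm F_coco _ _) _.
near: y; move: {e0}(mulr_gt0 kappa_gt0 e0); move: (_ * e) => d d0.
by have /cvgrPdist_le := @cvg_id _ (nbhs x); exact.
Unshelve. all: by end_near. Qed.

(* For [y = x - eta F x], cocoercivity at [(y, x)] reads
   [- eta <F x, F y - F x> >= kappa |F y - F x|^2]. *)
Lemma cocoercive_step_norm x eta : 0 <= eta -> eta <= 2 * kappa ->
  `|F (x - eta *: F x)| <= `|F x|.
Proof.
rewrite le_eqVlt => /predU1P[<- _|eta0 eta2]; first by rewrite scale0r subr0.
have := F_coco (x - eta *: F x) x.
rewrite addrAC subrr add0r; set y := F (_ - _).
rewrite -(dotxx dot_norm) !dotE (dotC (F x) y) => h.
rewrite -(@ler_pXn2r _ 2)// ?nnegrE// -!(dotxx dot_norm).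
have : eta * (dot y y - dot (F x) (F x)) <= 0.
  have := dot_ge0 (y - F x) : 0 <= dot _ _; rewrite !dotE (dotC (F x) y) => h1.
  have : eta * (dot y y - dot y (F x) - (dot y (F x) - dot (F x) (F x))) <=
    2 * kappa * (dot y y - dot y (F x) - (dot y (F x) - dot (F x) (F x))).
    by apply: ler_wpM2r => //; move: h1; lra.
  move: h; lra.
by rewrite pmulr_rle0// subr_le0.
Qed.

(** Expanding the square with [w = x - z], the change is at most
    [- eta * (2 * kappa - eta) * |F x| ^+ 2]. *)
Lemma cocoercive_step_dist z x eta : F z = 0 -> 0 <= eta -> eta <= 2 * kappa ->
  `|x - eta *: F x - z| <= `|x - z|.
Proof.
move=> Fz eta0 eta2; have := F_coco x z; rewrite Fz subr0 addrAC.
rewrite -(dotxx dot_norm); move: (x - z) => w h.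
rewrite -(@ler_pXn2r _ 2)// ?nnegrE// -!(dotxx dot_norm) !dotE (dotC (F x) w).
have h1 : 0 <= dot (F x) (F x) by exact: dot_ge0.
have := mulr_ge0 eta0 h1; have : 0 <= 2 * kappa - eta by rewrite subr_ge0.
move=> h2 h3; have := mulr_ge0 h2 h3; have := ler_wpM2l eta0 h; nra.
Qed.

Variables (t0 theta0 : R) (theta g : R -> R) (f u : R -> H).
Hypotheses (theta0_gt0 : 0 < theta0)
  (theta_ge : forall t, t0 <= t -> theta0 <= theta t)
  (g_ge0 : forall t, 0 <= g t) (g_int : mu.-integrable `[t0, +oo[ (EFin \o g))
  (u_ac : forall b, t0 < b -> absolutely_continuous t0 b u)
  (u_ode : {ae mu, forall t, t0 <= t -> [/\ derivable u t 1,
     u^`()%classic t + theta t *: F (u t) = f t & g t = `|f t|]}).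

Let u_ac_itv s t : t0 <= s -> s <= t -> absolutely_continuous s t u.
Proof.
move=> ts st; apply: (absolutely_continuousS ts (lexx t)) => //.
have tt : t0 <= t by exact: le_trans st.
have := @u_ac (t + 1); rewrite (le_lt_trans tt) ?ltrDl// => /(_ isT).
by apply: absolutely_continuousS => //; rewrite lerDl.
Qed.

(** To first order [u (t + h)] is a step of length [h * theta t] along [- F], which does not raise
    [phi], plus [h *: f t], which costs at most [L * h * |f t|]. Only the Lipschitz property of
    [phi] is used, so norms are allowed. *)
Lemma flow_lyapunov (phi : H -> R) (L : R) : 0 <= L ->
  (forall x y, `|phi x - phi y| <= L * `|x - y|) ->
  (forall x eta, 0 <= eta -> eta <= 2 * kappa -> phi (x - eta *: F x) <= phi x) ->
  forall s t, t0 <= s -> s <= t ->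
    phi (u t) <= phi (u s) + L * \int[mu]_(x in `[s, t]) g x.
Proof.
move=> L0 phiL phiF s t ts st.
have gst := integrable_itv g_int t ts.
rewrite addrC -lerBlDr -RintegralZl//.
apply: (ac_dini_le (v := phi \o u)) => //.
- apply: absolutely_continuous_lip (u_ac_itv ts st) => x y _ _ _; exact: phiL.
- exact: integrable_EFinZl.
- apply: (@filterS _ _ (ae_filter_ringOfSetsType mu) _ _ _ u_ode) => x ux sx xt e e0.
  have tx : t0 <= x by exact: le_trans sx.
  have [ud uE gE] := ux tx.
  (* [L] may be 0; with this tolerance the remainder costs [L * (e / (L + 1)) <= e]. *)
  have e1 : 0 < e / (L + 1) by rewrite divr_gt0// ltr_wpDl.
  have th0 : 0 < theta x by apply: lt_le_trans (theta_ge tx).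
  have hk : \forall h \near 0^'+, h <= 2 * kappa / theta x.
    by apply: nbhs_right_le; rewrite divr_gt0// mulr_gt0.
  have h0 : \forall h \near (0 : R)^'+, 0 < h by exact: nbhs_right_gt.
  apply: filterS3 (derivable_right_approx ud e1) hk h0 => h uh hk h0.
  have hth : h * theta x <= 2 * kappa by rewrite -ler_pdivlMr.
  have hth0 : 0 <= h * theta x by rewrite mulr_ge0// ltW.
  apply: le_trans (lerD (phiF (u x) _ hth0 hth) (lexx (h * (L * g x + e)))).
  rewrite -lerBlDl; apply: le_trans (ler_norm _) (le_trans (phiL _ _) _).
  have : `|u (x + h) - (u x - (h * theta x) *: F (u x))| <= h * (g x + e / (L + 1)).
    have -> : u (x + h) - (u x - (h * theta x) *: F (u x)) =
       (u (x + h) - (u x + h *: u^`()%classic x)) + h *: f x.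
      rewrite -uE scalerDr scalerA !opprD opprK !addrA; congr (_ + _).
      by rewrite subrK.
    rewrite mulrDr [leRHS]addrC; apply: le_trans (ler_normD _ _) (lerD uh _).
    by rewrite normrZ gE gtr0_norm.
  move=> /(ler_wpM2l L0) /le_trans; apply.
  rewrite mulrCA ler_pM2l// mulrDr lerD2l mulrCA ger_pMr// ler_pdivrMr ?ltr_wpDl//.
  by rewrite mul1r lerDl.
Qed.

Lemma flow_dist z s t : F z = 0 -> t0 <= s -> s <= t ->
  `|u t - z| <= `|u s - z| + 1 * \int[mu]_(x in `[s, t]) g x.
Proof.
move=> Fz; apply: (flow_lyapunov (phi := fun x => `|x - z|)) => // [x y|x eta].
  rewrite mul1r; apply: le_trans (ler_dist_dist _ _) _.
  by rewrite opprB addrA subrK.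
exact: cocoercive_step_dist.
Qed.

Lemma flow_residual s t : t0 <= s -> s <= t ->
  `|F (u t)| <= `|F (u s)| + kappa^-1 * \int[mu]_(x in `[s, t]) g x.
Proof.
apply: (flow_lyapunov (phi := fun x => `|F x|)) => [|x y|x eta].
- by rewrite invr_ge0 ltW.
- apply: le_trans (ler_dist_dist _ _) _.
  by rewrite mulrC ler_pdivlMr// mulrC
    (cocoercive_lipschitz dot_norm F_coco).
- exact: cocoercive_step_norm.
Qed.

Lemma flow_bounded z : F z = 0 ->
  exists2 M, 0 <= M & forall t, t0 <= t -> `|u t - z| <= M.
Proof.
move=> Fz; exists (`|u t0 - z| + \int[mu]_(x in `[t0, +oo[) g x).
  by rewrite addr_ge0// Rintegral_ge0.
move=> t tt; apply: le_trans (flow_dist Fz (lexx _) tt) _.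
by rewrite mul1r lerD2l (Rintegral_itv_le g_ge0 g_int).
Qed.

Lemma flow_integrable_itv (Psi : H -> R) t : continuous Psi ->
  mu.-integrable `[t0, t] (fun s => (Psi (u s))%:E).
Proof.
move=> Psic; apply: (@continuous_compact_integrable _ (Psi \o u)).
  exact: segment_compact.
have [tt|tt] := leP t0 t.
  apply: within_continuous_comp; first by move=> x _; exact: Psic.
  exact: absolutely_continuous_continuous (u_ac_itv (lexx _) tt).
by rewrite set_itv_ge ?bnd_simp -?ltNge//; exact: continuous_subspace0.
Qed.

(** Integrating the Dini bound of [|u - z| ^+ 2] leaves [2 * theta0] times the integral of [Psi]
    below the initial squared distance plus [2 * M] times the integral of [g]. [Psi] is left general
    to cover both the residual and the resolvent combination. *)
Lemma flow_dissipation (Psi : H -> R) z : F z = 0 -> continuous Psi ->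
  (forall x, 0 <= Psi x) -> (forall x, Psi x <= dot (x - z) (F x)) ->
  exists K, forall t, t0 <= t -> \int[mu]_(s in `[t0, t]) Psi (u s) <= K.
Proof.
move=> Fz Psic Psi0 PsiF; have [M M0 uM] := flow_bounded Fz.
pose K := \int[mu]_(x in `[t0, +oo[) g x.
exists ((`|u t0 - z| ^+ 2 + 2 * M * K) / (2 * theta0)) => t tt.
have gt := integrable_itv g_int t (lexx t0).
have Pt := flow_integrable_itv t Psic.
have gi : mu.-integrable `[t0, t] (EFin \o (fun s => 2 * M * g s)).
  exact: integrable_EFinZl.
have Pi : mu.-integrable `[t0, t] (EFin \o (fun s => 2 * theta0 * Psi (u s))).
  exact: integrable_EFinZl.
suff : `|u t - z| ^+ 2 - `|u t0 - z| ^+ 2 <=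
    \int[mu]_(s in `[t0, t]) (2 * M * g s - 2 * theta0 * Psi (u s)).
  rewrite RintegralB// !RintegralZl// => h.
  rewrite ler_pdivlMr ?mulr_gt0// mulrC.
  have h2 : 2 * M * \int[mu]_(x in `[t0, t]) g x <= 2 * M * K.
    by rewrite ler_wpM2l ?mulr_ge0// (Rintegral_itv_le g_ge0 g_int).
  rewrite -lerBlDl; apply: le_trans h2; move: h; rewrite lerBrDr; apply: le_trans.
  by rewrite addrAC lerD2r lerDr sqr_ge0.
apply: (ac_dini_le (v := fun s => `|u s - z| ^+ 2)) => //.
- apply: (absolutely_continuous_lip (C := 2 * M)) (u_ac_itv (lexx _) tt).
  move=> x y tx xy _.
  rewrite subr_sqr normrM mulrC; apply: ler_pM => //.
    rewrite ger0_norm ?addr_ge0//.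
    by have := uM _ tx; have := uM _ (le_trans tx xy); lra.
  by apply: le_trans (ler_dist_dist _ _) _; rewrite opprB addrA subrK.
- have := @integrableB _ _ _ mu `[t0, t]%classic (measurable_itv _) _ _ gi Pi.
  by apply: eq_integrable => // x _; rewrite /= EFinB.
apply: (@filterS _ _ (ae_filter_ringOfSetsType mu) _ _ _ u_ode) => x ux tx xt e e0.
have [ud uE gE] := ux tx.
set p := u^`()%classic x in uE; set w := u x - z.
have wM : `|w| <= M by exact: uM.
have wp : dot w p <= M * g x - theta0 * Psi (u x).
  have -> : p = f x - theta x *: F (u x) by rewrite -uE addrK.
  rewrite dotDr dotNr dotZr; apply: lerB.
    by apply: le_trans (ler_dot dot_norm _ _) _; rewrite gE ler_wpM2r.
  by apply: ler_pM; [exact: ltW|exact: Psi0|exact: theta_ge|exact: PsiF].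
have M1 : 0 < M + 1 by rewrite ltr_wpDl.
(* Half of [e] absorbs the error [2 * (M * e1)] of the difference quotient [q], the other half the
   second-order term [h * |q| ^+ 2]. *)
pose e1 := e / (4 * (M + 1)).
have e1_gt0 : 0 < e1 by rewrite divr_gt0// mulr_gt0.
have e1E : 4 * (M * e1) + 4 * e1 = e by rewrite /e1; field; rewrite gt_eqF.
pose c := (`|p| + e1) ^+ 2 + 1.
have c0 : 0 < c by rewrite ltr_wpDl// sqr_ge0.
have hc : \forall h \near 0^'+, h <= e / 2 / c.
  by apply: nbhs_right_le; rewrite !divr_gt0.
have h0 : \forall h \near (0 : R)^'+, 0 < h by exact: nbhs_right_gt.
apply: filterS3 (derivable_right_approx ud e1_gt0) hc h0 => h uh hc h0.
pose q := h^-1 *: (u (x + h) - u x).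
have -> : u (x + h) - z = w + h *: q.
  by rewrite /q scalerA mulfV ?gt_eqF// scale1r /w [RHS]addrC addrA subrK.
have qp : `|q - p| <= e1.
  rewrite -(ler_pM2l h0) -{1}[h]gtr0_norm// -normrZ scalerBr /q scalerA mulfV ?gt_eqF//.
  by rewrite scale1r -addrA -opprD.
have qc : h * `|q| ^+ 2 <= e / 2.
  have : `|q| ^+ 2 <= c.
    rewrite /c; apply: (@le_trans _ _ ((`|p| + e1) ^+ 2)); last by rewrite lerDl.
    rewrite ler_pXn2r ?nnegrE ?addr_ge0 ?(ltW e1_gt0)//.
    by rewrite -[q](subrK p) addrC (le_trans (ler_normD _ _))// lerD2l.
  by move=> /(ler_wpM2l (ltW h0)) /le_trans; apply; rewrite -ler_pdivlMr.
have wq : dot w q <= dot w p + M * e1.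
  rewrite -[q](subrK p) dotDr addrC lerD2l.
  by apply: le_trans (ler_dot dot_norm _ _) _; exact: ler_pM.
have -> : `|w + h *: q| ^+ 2 = `|w| ^+ 2 + h * (2 * dot w q + h * `|q| ^+ 2).
  by clearbody q w; rewrite -!(dotxx dot_norm) !dotE (dotC q w); ring.
rewrite lerD2l ler_pM2l//.
suff step (a b1 b2 b3 b4 b5 b6 : R) : a <= b1 + b2 -> b1 <= b3 - b4 -> b5 <= e / 2 ->
  4 * b2 + 4 * e1 = e -> 2 * a + b5 <= 2 * b3 - 2 * b4 + e.
  by rewrite -!mulrA; exact: step wq wp qc e1E.
move: e0 e1_gt0; lra.
Qed.

Lemma flow_dissipation_integrable (Psi : H -> R) z : F z = 0 ->
  continuous Psi -> (forall x, 0 <= Psi x) ->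
  (forall x, Psi x <= dot (x - z) (F x)) ->
  mu.-integrable `[t0, +oo[ (fun s => (Psi (u s))%:E).
Proof.
move=> Fz Psic Psi0 PsiF; have [K uK] := flow_dissipation Fz Psic Psi0 PsiF.
apply: (@integrable_half_line _ t0 K (Psi \o u)) => // [t|t]; first exact: Psi0.
exact: flow_integrable_itv.
Qed.

Lemma continuous_residual_sq : continuous (fun x => kappa * `|F x| ^+ 2).
Proof.
move=> x; apply: cvgM; first exact: cvg_cst.
by apply: cvg_normsq; exact: cocoercive_continuous.
Qed.

Lemma residual_sq_le z x : F z = 0 -> kappa * `|F x| ^+ 2 <= dot (x - z) (F x).
Proof. by move=> Fz; have := F_coco x z; rewrite Fz subr0. Qed.

Lemma flow_residual_integrable z : F z = 0 ->
  mu.-integrable `[t0, +oo[ (fun s => (`|F (u s)| ^+ 2)%:E).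
Proof.
move=> Fz; have := @flow_dissipation_integrable _ z Fz continuous_residual_sq.
move=> /(_ _ _)/(integrable_EFinZl kappa^-1) h.
apply: eq_integrable (h _ _ _) => // [s _|x|x].
- by rewrite /= mulKf ?gt_eqF.
- by rewrite mulr_ge0// ltW.
- exact: residual_sq_le.
Qed.

Lemma flow_residual_cvg0 z : F z = 0 -> F (u t) @[t --> +oo] --> 0.
Proof.
move=> Fz; have h1 x : 0 <= kappa * `|F x| ^+ 2 by rewrite mulr_ge0// ltW.
have [K uK] := flow_dissipation Fz continuous_residual_sq h1
  (fun x => residual_sq_le x Fz).
apply/norm_cvg0P; apply: (@perturbed_nonincreasing_cvg0 _ t0 g g_ge0 g_int _ kappa^-1 _ _ _
  (kappa^-1 * K)) => //.
- by rewrite invr_ge0 ltW.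
- exact: flow_residual.
- move=> t; apply: flow_integrable_itv (fun x => `|F x| ^+ 2) _ _ => x.
  by apply: cvg_normsq; exact: cocoercive_continuous.
- move=> t tt; have := uK t tt.
  have -> : \int[mu]_(s in `[t0, t]) (kappa * `|F (u s)| ^+ 2) =
    kappa * \int[mu]_(s in `[t0, t]) (`|F (u s)| ^+ 2).
    rewrite RintegralZl//.
    apply: (flow_integrable_itv (Psi := fun x => `|F x| ^+ 2)) => x.
    by apply: cvg_normsq; exact: cocoercive_continuous.
  by rewrite mulrC -ler_pdivlMr// mulrC.
Qed.

Lemma flow_dist_cvg z : F z = 0 -> cvg (`|u t - z| @[t --> +oo]).
Proof.
move=> Fz; apply: (@perturbed_nonincreasing_cvg _ t0 g g_ge0 g_int _ 1) => //.
by move=> s t; exact: flow_dist.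
Qed.

Lemma flow_weak_cvg z : F z = 0 -> exists2 x, F x = 0 & weak_cvg dot +oo u x.
Proof.
move=> Fz; have [M _ uM] := flow_bounded Fz.
apply: (@opial_weak_cvg _ _ _ dot_norm _ _ F kappa u (M + `|z|)) => //.
- near=> t; rewrite -[u t](subrK z); apply: le_trans (ler_normD _ _) _.
  by rewrite lerD2r uM//; near: t; apply: nbhs_pinfty_ge; exact: num_real.
- exact: flow_residual_cvg0 Fz.
- exact: flow_dist_cvg.
Unshelve. all: by end_near. Qed.

End flow.

(** * The Douglas-Rachford trajectory as a perturbed flow of [I - T] *)

Theorem theorem4p2 (R : realType) (H : completeNormedModType R)
    (dot : {dot H for idfun}) (dot_norm : induces_norm dot)
    (t0 : R) (t0_gt0 : 0 < t0)
    (theta : R -> R) (theta_ge0 : forall t, t0 <= t -> 0 <= theta t)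
    (theta_loc : L1loc `[t0, +oo[ theta)
    (f : R -> H) (f_L1 : L1 `[t0, +oo[ f)
    (A B : H -> set H) (alpha beta gamma delta lambda mu epsilon : R)
    (A_max : max_monotone_op dot alpha A) (B_max : max_monotone_op dot beta B)
    (mu_lambda : mu = lambda) (lambda_2 : lambda = 2)
    (gamma_delta : gamma = delta) (delta_gt0 : 0 < delta)
    (epsilon_gt0 : 0 < epsilon) (epsilon_lt1 : epsilon < 1)
    (alpha_beta : 0 < alpha + beta)
    (gamma_cond : epsilon - 1 < gamma * alpha * beta / (alpha + beta))
    (inf_theta : 0 < inf (theta @` `[t0, +oo[)) :
  let JA := resolvent gamma A in
  let RA := relaxed_resolvent lambda gamma A in
  let JB := resolvent delta B in
  let RB := relaxed_resolvent mu delta B in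
  let T := fun x => RB (RA x) in
  forall (u0 : H) (u : R -> H)
    (u_sol : strong_global_solution t0 theta T f u0 u)
    (us : H) (us_fix : Fix T us),
  let Phi := fun t =>
    `|alpha *: (JA (u t) - JA us) + beta *: (JB (RA (u t)) - JB (RA us))| in
  (@lebesgue_measure R).-integrable `[t0, +oo[
    (fun s => (`|T (u s) - u s| ^+ 2)%:E) /\
  `|T (u t) - u t| @[t --> +oo] --> (0 : R) /\
  (demiclosedness_principle dot T ->
    exists2 uh : H, Fix T uh & weak_cvg dot +oo u uh) /\
  (@lebesgue_measure R).-integrable `[t0, +oo[ (fun s => (Phi s ^+ 2)%:E) /\
  Phi t @[t --> +oo] --> (0 : R) /\
  [/\ JA (u t) @[t --> +oo] --> JA us,
      JA us = JB (RA us),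
      JB (RA (u t)) @[t --> +oo] --> JB (RA us)
    & zer (add_op A B) = [set JA us]].
Proof.
move=> JA RA JB RB T u0 u [u_ac u_ode _] us us_fix Phi.
subst mu lambda gamma; rename delta into gamma.
have kappa_gt0 : 0 < epsilon / 2 by rewrite divr_gt0.
have c_gt0 : 0 < 2 * gamma / (alpha + beta) by rewrite divr_gt0// mulr_gt0.
set c := 2 * gamma / (alpha + beta) in c_gt0.
pose F x := x - T x.
have Fus : F us = 0 by rewrite /F us_fix subrr.
have key x y := douglas_rachford_cocoercive dot_norm A_max B_max delta_gt0
  epsilon_gt0 alpha_beta gamma_cond x y.
have F_coco x y : epsilon / 2 * `|F x - F y| ^+ 2 <= dot (x - y) (F x - F y).
  by apply: le_trans (key x y); rewrite lerDl mulr_ge0 ?sqr_ge0// ltW.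
have [JAB zerE] : JA us = JB (RA us) /\ zer (add_op A B) = [set JA us].
  exact: (douglas_rachford_fix dot_norm A_max B_max delta_gt0
    epsilon_gt0 alpha_beta gamma_cond us_fix).
have [JAc JBc] := douglas_rachford_resolvent_continuous dot_norm A_max B_max
  delta_gt0 epsilon_gt0 alpha_beta gamma_cond.
have FE x : F x = 2 *: (JA x - JB (RA x)) by exact: douglas_rachfordE.
have [g [g_ge0 g_int g_eq]] := L1_norm_ae_eq (measurable_itv _) f_L1.
have theta_ge t : t0 <= t -> inf (theta @` `[t0, +oo[) <= theta t.
  move=> tt; apply: ge_inf; last by exists t => //=; rewrite in_itv/= tt.
  by exists 0 => _ [s /=] /[!in_itv]/= /andP[ts _] <-; exact: theta_ge0.
have ode : {ae @lebesgue_measure R, forall t, t0 <= t -> [/\ derivable u t 1,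
     u^`()%classic t + theta t *: F (u t) = f t & g t = `|f t|]}.
  apply: (@filterS2 _ _ (ae_filter_ringOfSetsType _) _ _ _ _ u_ode g_eq).
  move=> t ut gt tt; have [ud uE] := ut tt; split => //.
  by apply: gt; rewrite /= in_itv/= tt.
(* The second term of the cocoercivity inequality, taken at [y = us], where [F] vanishes. *)
pose Psi x := c * `|alpha *: (JA x - JA us) + beta *: (JB (RA x) - JB (RA us))| ^+ 2.
have Psi_ge0 x : 0 <= Psi x by rewrite mulr_ge0 ?sqr_ge0// ltW.
have Psi_le x : Psi x <= dot (x - us) (F x).
  have := key x us; rewrite -/(F x) -/(F us) Fus subr0; apply: le_trans.
  by rewrite lerDr mulr_ge0 ?sqr_ge0// ltW.
have Psi_cont : continuous Psi.
  move=> x; apply: cvgM; first exact: cvg_cst.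
  apply: cvg_normsq; apply: cvgD; apply: cvgZ; try exact: cvg_cst.
    by apply: cvgB; [exact: JAc|exact: cvg_cst].
  by apply: cvgB; [exact: JBc|exact: cvg_cst].
have Fu0 := flow_residual_cvg0 dot_norm kappa_gt0 F_coco inf_theta theta_ge g_ge0
  g_int u_ac ode Fus.
have [M M0 uM] := flow_bounded dot_norm kappa_gt0 F_coco inf_theta theta_ge g_ge0
  g_int u_ac ode Fus.
have TuE t : `|T (u t) - u t| = `|F (u t)| by rewrite distrC.
have nFu0 : `|F (u t)| @[t --> +oo] --> (0 : R) by apply/norm_cvg0P.
have Phi0 : Phi t @[t --> +oo] --> (0 : R).
  apply/cvgrPdist_le => e e0.
  (* The bound [c * Phi t ^+ 2 <= dot (u t - us) (F (u t)) <= M * |F (u t)|] dictates this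
     threshold. *)
  have d0 : 0 < c * e ^+ 2 / (M + 1) by rewrite divr_gt0 ?ltr_wpDl// mulr_gt0// exprn_gt0.
  have /cvgrPdist_le/(_ _ d0) := nFu0; apply: filterS2; last first.
    exact: (nbhs_pinfty_ge (num_real t0)).
  move=> t; rewrite !sub0r !normrN !normr_id => tt Fe.
  rewrite -(@ler_pXn2r _ 2)// ?nnegrE ?(ltW e0)// -(ler_pM2l c_gt0).
  apply: le_trans (Psi_le (u t)) (le_trans (ler_dot dot_norm _ _) _).
  rewrite ler_pdivlMr ?ltr_wpDl// in Fe; apply: le_trans Fe; rewrite mulrC.
  by rewrite ler_wpM2l// (le_trans (uM _ tt))// lerDl.
have JAu : JA (u t) @[t --> +oo] --> JA us.
  pose V t := alpha *: (JA (u t) - JA us) + beta *: (JB (RA (u t)) - JB (RA us)).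
  have V0 : V t @[t --> +oo] --> 0 by apply/norm_cvg0P.
  (* As [F] is twice the difference of the resolvents and these agree at [us], adding
     [(beta / 2) *: F (u t)] to [V t] replaces the second resolvent by the first; [alpha + beta] can
     then be divided out. *)
  have -> : (fun t => JA (u t)) = fun t =>
      JA us + (alpha + beta)^-1 *: (V t + (beta / 2) *: F (u t)).
    apply/funext => t.
    have -> : V t + (beta / 2) *: F (u t) = (alpha + beta) *: (JA (u t) - JA us).
      rewrite FE scalerA divfK ?pnatr_eq0// /V -JAB -addrA -scalerDr.
      by rewrite [X in beta *: X]addrC addrA subrK scalerDl.
    by rewrite scalerA mulVf ?gt_eqF// scale1r addrC subrK.
  rewrite -[X in _ --> X]addr0; apply: cvgD; first exact: cvg_cst.
  rewrite -[X in _ --> X](scaler0 _ (alpha + beta)^-1); apply: cvgZ; first exact: cvg_cst.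
  rewrite -[X in _ --> X]addr0; apply: cvgD => //.
  by rewrite -[X in _ --> X](scaler0 _ (beta / 2)); apply: cvgZ => //; exact: cvg_cst.
split; [|split; [|split; [|split; [|split; [|split]]]]] => //.
- have := flow_residual_integrable dot_norm kappa_gt0 F_coco inf_theta theta_ge g_ge0
    g_int u_ac ode Fus.
  by apply: eq_integrable => // s _; rewrite TuE.
- by rewrite (_ : (fun t => `|T (u t) - u t|) = fun t => `|F (u t)|)//; apply/funext.
- move=> _; have [x Fx ux] := flow_weak_cvg dot_norm kappa_gt0 F_coco inf_theta
    theta_ge g_ge0
    g_int u_ac ode Fus.
  by exists x => //; move/eqP: Fx; rewrite subr_eq0 => /eqP.
- have := flow_dissipation_integrable dot_norm kappa_gt0 F_coco inf_theta theta_ge g_ge0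
    g_int u_ac ode Fus Psi_cont Psi_ge0 Psi_le.
  move/(integrable_EFinZl c^-1 (measurable_itv _)); apply: eq_integrable => // s _.
  by rewrite /= /Psi mulKf ?gt_eqF.
- have -> : (fun t => JB (RA (u t))) = fun t => JA (u t) - 2^-1 *: F (u t).
    by apply/funext => t; rewrite FE scalerA mulVf ?pnatr_eq0// scale1r opprB addrC subrK.
  rewrite -JAB -[X in _ --> X]subr0; apply: cvgB => //.
  by rewrite -[X in _ --> X](scaler0 _ 2^-1); apply: cvgZ => //; exact: cvg_cst.
Qed.
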